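(* Let $n\in\mathbb{N}$ and $\beta>1$. Then $R_{\mathcal{S}^*_{Ne,n}}(\mathcal{M}_n(\beta))=(3\beta-2)^{-1/n}$, and the result is sharp for $f(z)=z(1-z^n)^{2(\beta-1)/n}$.
   Context: $\mathbb{D}=\{|z|<1\}$, $\mathbb{D}_r=\{|z|<r\}$. For $n\in\mathbb{N}$, $\mathcal{A}_n$ is the class of analytic functions on $\mathbb{D}$ of the form $f(z)=z+\sum_{k\ge n+1}a_kz^k$; for such $f$ let $\mathcal{Q}_f(z)=zf'(z)/f(z)$. For $\beta>1$, $\mathcal{M}_n(\beta)=\{f\in\mathcal{A}_n:\mathrm{Re}\,\mathcal{Q}_f(z)<\beta,\ z\in\mathbb{D}\}$ (equivalently $\mathcal{Q}_f\prec\frac{1+(1-2\beta)z^n}{1-z^n}$). Let $\varphi_{Ne}(z)=1+z-z^3/3$ (univalent on $\mathbb{D}$), $\Omega_{Ne}=\varphi_{Ne}(\mathbb{D})$, $\mathcal{S}^*_{Ne}$ the set of $f$ ($f(0)=0,f'(0)=1$) with $\mathcal{Q}_f\prec\varphi_{Ne}$ (subordination: $\mathcal{Q}_f=\varphi_{Ne}\circ w$, $w:\mathbb{D}\to\mathbb{D}$ analytic, $w(0)=0$), $\mathcal{S}^*_{Ne,n}=\mathcal{S}^*_{Ne}\cap\mathcal{A}_n$. For $\mathcal{G}\subset\mathcal{A}_n$, $R_{\mathcal{S}^*_{Ne,n}}(\mathcal{G})$ is the largest $\rho\in(0,1]$ such that $\mathcal{Q}_f(\mathbb{D}_\rho)\subseteq\Omega_{Ne}$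 for all $f\in\mathcal{G}$. Sharpness means the stated $f$ lies in $\mathcal{M}_n(\beta)$ and $\mathcal{Q}_f(\partial\mathbb{D}_\rho)\cap\partial\Omega_{Ne}\ne\emptyset$. *)

(* Defs.v *)
From Stdlib Require Import Reals Lra.
Open Scope R_scope.

Definition Cx : Type := (R * R)%type.
Definition Re (z : Cx) : R := fst z.
Definition Im (z : Cx) : R := snd z.
Definition RtoC (x : R) : Cx := (x, 0).
Definition Cadd (z w : Cx) : Cx := (Re z + Re w, Im z + Im w).
Definition Copp (z : Cx) : Cx := (- Re z, - Im z).
Definition Csub (z w : Cx) : Cx := Cadd z (Copp w).
Definition Cmul (z w : Cx) : Cx :=
  (Re z * Re w - Im z * Im w, Re z * Im w + Im z * Re w).
Definition Cnorm (z : Cx) : R := sqrt (Re z * Re z + Im z * Im z).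
Definition Cinv (z : Cx) : Cx :=
  let d := Re z * Re z + Im z * Im z in (Re z / d, - Im z / d).
Definition Cdiv (z w : Cx) : Cx := Cmul z (Cinv w).
Fixpoint Cpow (z : Cx) (k : nat) : Cx :=
  match k with O => RtoC 1 | S k' => Cmul z (Cpow z k') end.

Fixpoint Csum (g : nat -> Cx) (m : nat) : Cx :=
  match m with O => g O | S m' => Cadd (Csum g m') (g (S m')) end.

Definition Cseries_to (g : nat -> Cx) (s : Cx) : Prop :=
  forall eps, eps > 0 -> exists N : nat, forall m : nat, (m >= N)%nat ->
    Cnorm (Csub (Csum g m) s) < eps.

Definition cderiv (f : Cx -> Cx) (z l : Cx) : Prop :=
  forall eps, eps > 0 -> exists delta, delta > 0 /\ forall h : Cx,
    0 < Cnorm h < delta ->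
    Cnorm (Csub (Cdiv (Csub (f (Cadd z h)) (f z)) h) l) < eps.

Definition class_A (n : nat) (f : Cx -> Cx) : Prop :=
  exists a : nat -> Cx,
    a 0%nat = RtoC 0 /\ a 1%nat = RtoC 1 /\
    (forall k : nat, (2 <= k <= n)%nat -> a k = RtoC 0) /\
    (forall z : Cx, Cnorm z < 1 -> Cseries_to (fun k => Cmul (a k) (Cpow z k)) (f z)).

Definition Qf_val (f : Cx -> Cx) (z w : Cx) : Prop :=
  (z = RtoC 0 /\ w = RtoC 1) \/
  (z <> RtoC 0 /\ f z <> RtoC 0 /\
     exists l : Cx, cderiv f z l /\ w = Cdiv (Cmul z l) (f z)).

Definition Qf_sat (f : Cx -> Cx) (z : Cx) (P : Cx -> Prop) : Prop :=
  exists w, Qf_val f z w /\ P w.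

Definition class_M (n : nat) (beta : R) (f : Cx -> Cx) : Prop :=
  class_A n f /\ forall z : Cx, Cnorm z < 1 -> Qf_sat f z (fun w => Re w < beta).

Definition phi_Ne (u : Cx) : Cx :=
  Cadd (RtoC 1) (Csub u (Cmul (RtoC (1/3)) (Cpow u 3))).
Definition in_Omega_Ne (w : Cx) : Prop := exists u, Cnorm u < 1 /\ w = phi_Ne u.
Definition on_boundary_Omega_Ne (w : Cx) : Prop :=
  ~ in_Omega_Ne w /\
  forall eps, eps > 0 -> exists v, in_Omega_Ne v /\ Cnorm (Csub v w) < eps.

Definition radius_admissible (G : (Cx -> Cx) -> Prop) (rho : R) : Prop :=
  0 < rho <= 1 /\
  forall f, G f -> forall z : Cx, Cnorm z < rho -> Qf_sat f z in_Omega_Ne.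

Definition is_radius (G : (Cx -> Cx) -> Prop) (rho : R) : Prop :=
  radius_admissible G rho /\ forall r, radius_admissible G r -> r <= rho.

(* principal power w^s (s real), for Re w > 0: principal argument = atan(Im/Re) *)
Definition cpow_pos (w : Cx) (s : R) : Cx :=
  let r := Cnorm w in let th := atan (Im w / Re w) in
  (Rpower r s * cos (s * th), Rpower r s * sin (s * th)).

Definition f_extremal (n : nat) (beta : R) (z : Cx) : Cx :=
  Cmul z (cpow_pos (Csub (RtoC 1) (Cpow z n)) (2 * (beta - 1) / INR n)).

(* Main.v *)
Require Import Defs.
From Stdlib Require Import Reals Lra Lia Psatz Classical ClassicalEpsilon.
From Coquelicot Require Import Coquelicot.
Open Scope R_scope.

(** For [f] in [class_M n beta] put [X = Q_f - 1], so that [2 Re X < c] with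
    [c = 2 (beta - 1)]. Then [omega = X / (c - X)] maps the disc into itself and vanishes to order
    [n] at the origin, and the Schwarz lemma gives [|omega z| <= |z|^n]. Since [X (1 + omega) = c omega],
    [|z|^n < 1 / (3 beta - 2)] forces [|X| < 2/3]; and [Omega_Ne] contains the disc of centre [1] and
    radius [2/3] because [u = v + u^3 / 3] can be solved by iteration when [|v| < 2/3]. For the
    extremal function [X = - c z^n / (1 - z^n)], which is [-2/3] at the critical radius, and
    [1/3 = phi_Ne (-1)] is a boundary point.

    The maximum principle behind the Schwarz lemma needs no integration: a quotient of power series
    has a second-order Taylor expansion at every point, so at an interior maximum of
    [|G|^2 + eps |z|^2] the mean over four nearby points would exceed the maximum. *)

(** * Complex series *)

(** Two gaps shape the proof. First, [class_A] supplies nothing but a power series, so the Schwarz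
    argument is carried out on coefficients: with [f = z g] one has [X = z g' / g], hence
    [omega = z g' / (c g - z g')]. Once [z^n] is cancelled from the numerator series, [omega / z^n]
    is a quotient of two power series whose denominator is nonzero on the whole disc, with value [c]
    at the origin, so no singularity has to be removed before the maximum principle is applied.
    Second, the extremal function is given by a principal power written with [atan], whereas
    [class_A] asks for Taylor coefficients and [Qf_val] for a complex derivative. The bridge is the
    binomial series [B]: it solves [(1 - u) B' = - s B] with [B(0) = 1], and along each ray from the
    origin this linear equation forces [B] to be the principal power. Complex derivatives are then
    taken of series only. *)

Notation is_CSeries := (@is_series C_AbsRing C_NormedModule).

(** [Cx] and [C] are both [R * R], with convertible sum, product and opposite; only modulus,
    inverse, powers and finite sums need the translation lemmas, and [change] does the rest. *)
Lemma Cnorm_Cmod (z : C) : Cnorm z = Cmod z.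
Proof. unfold Cnorm, Cmod, Defs.Re, Defs.Im; f_equal; simpl; ring. Qed.

Lemma Cinv_Cinv (z : C) : Defs.Cinv z = (/ z)%C.
Proof.
  unfold Defs.Cinv, Cinv, Defs.Re, Defs.Im; simpl.
  rewrite !Rmult_1_r; reflexivity.
Qed.

Lemma Cdiv_Cdiv (z w : C) : Defs.Cdiv z w = (z / w)%C.
Proof. unfold Defs.Cdiv; rewrite Cinv_Cinv; reflexivity. Qed.

Lemma Cpow_Cpow (z : C) (k : nat) : Defs.Cpow z k = (z ^ k)%C.
Proof. induction k as [|k IH]; simpl; [|rewrite IH]; reflexivity. Qed.

Lemma Cmod_minus_sym (x y : C) : Cmod (x - y) = Cmod (y - x).
Proof. rewrite <- Cmod_opp; f_equal; ring. Qed.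

Lemma is_CSeries_eps (g : nat -> C) (s : C) :
  is_CSeries g s <-> (forall eps, eps > 0 -> exists N, forall m, (m >= N)%nat ->
                Cmod (sum_n g m - s)%C < eps).
Proof.
  split.
  - intros H eps Heps.
    pose proof (proj1 (filterlim_locally_ball_norm _ _) H (mkposreal eps Heps)) as [N HN].
    exists N; intros m Hm; exact (HN m Hm).
  - intros H. apply filterlim_locally_ball_norm. intros [eps Heps].
    destruct (H eps Heps) as [N HN]. exists N; intros m Hm; exact (HN m Hm).
Qed.

Lemma Csum_sum_n (g : nat -> C) (m : nat) : Csum g m = sum_n g m.
Proof.
  induction m as [|m IH]; simpl.
  - rewrite sum_O; reflexivity.
  - rewrite sum_Sn, IH; reflexivity.
Qed.

Lemma Cseries_to_CS (g : nat -> C) (s : C) : Cseries_to g s <-> is_CSeries g s.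
Proof.
  rewrite is_CSeries_eps; unfold Cseries_to.
  split; intros H eps Heps; destruct (H eps Heps) as [N HN]; exists N; intros m Hm.
  - specialize (HN m Hm). rewrite Cnorm_Cmod, Csum_sum_n in HN. exact HN.
  - rewrite Cnorm_Cmod, Csum_sum_n. exact (HN m Hm).
Qed.

Lemma is_CSeries_ext (g h : nat -> C) (s : C) : (forall k, g k = h k) -> is_CSeries g s -> is_CSeries h s.
Proof. intros E; apply is_series_ext; exact E. Qed.

Lemma is_CSeries_plus (g h : nat -> C) (s t : C) :
  is_CSeries g s -> is_CSeries h t -> is_CSeries (fun k => g k + h k)%C (s + t)%C.
Proof. exact (is_series_plus g h s t). Qed.

Lemma is_CSeries_scal (c : C) (g : nat -> C) (s : C) : is_CSeries g s -> is_CSeries (fun k => c * g k)%C (c * s)%C.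
Proof. exact (is_series_scal c g s). Qed.

Lemma is_CSeries_minus (g h : nat -> C) (s t : C) :
  is_CSeries g s -> is_CSeries h t -> is_CSeries (fun k => g k - h k)%C (s - t)%C.
Proof. exact (is_series_minus g h s t). Qed.

Lemma is_CSeries_prepend (g : nat -> C) (s : C) :
  is_CSeries (fun k => g (S k)) s -> is_CSeries g (g 0%nat + s)%C.
Proof.
  intros H. apply is_series_decr_1.
  match goal with |- is_series _ ?l => replace l with s; [exact H|] end.
  change (s = (g 0%nat + s) + - g 0%nat)%C; ring.
Qed.

Lemma is_CSeries_ex (g : nat -> C) (b : nat -> R) :
  (forall k, Cmod (g k) <= b k) -> ex_series b -> exists s, is_CSeries g s.
Proof.
  intros Hb Hs.
  exact (@ex_series_le C_AbsRing C_CompleteNormedModule g b Hb Hs).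
Qed.

Lemma is_CSeries_bound (g : nat -> C) (b : nat -> R) (s : C) :
  (forall k, Cmod (g k) <= b k) -> ex_series b -> is_CSeries g s -> Cmod s <= Series b.
Proof.
  intros Hb Hs Hg.
  assert (H : forall m, Cmod (sum_n g m) <= sum_n b m).
  { induction m as [|m IH]; [rewrite !sum_O; apply Hb|].
    rewrite !sum_Sn. eapply Rle_trans; [apply Cmod_triangle|].
    apply Rplus_le_compat; auto. }
  apply le_epsilon; intros eps Heps.
  destruct (proj1 (is_CSeries_eps g s) Hg (eps / 2)) as [N HN]; [lra|].
  pose proof (Series_correct _ Hs) as HB.
  pose proof (proj1 (filterlim_locally_ball_norm _ _) HB (mkposreal (eps / 2) ltac:(lra))) as [N' HN'].
  specialize (HN (max N N') ltac:(lia)).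
  specialize (HN' (max N N') ltac:(lia)).
  specialize (H (max N N')).
  set (m := max N N') in *.
  unfold ball_norm in HN'; simpl in HN'.
  change (Rabs (sum_n b m - Series b) < eps / 2) in HN'.
  apply Rabs_def2 in HN'.
  assert (Cmod s <= Cmod (sum_n g m) + Cmod (sum_n g m - s)).
  { rewrite Cmod_minus_sym. eapply Rle_trans; [|apply Cmod_triangle].
    right; f_equal; ring. }
  lra.
Qed.

Lemma is_CSeries_fst (g : nat -> C) (s : C) : is_CSeries g s -> is_series (fun k => fst (g k)) (fst s).
Proof.
  intros H. apply (filterlim_ext (fun m => fst (sum_n g m))).
  - induction x as [|m IH]; [rewrite !sum_O; reflexivity|].
    rewrite !sum_Sn, <- IH; reflexivity.
  - apply filterlim_locally_ball_norm; intros [eps Heps].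
    destruct (proj1 (is_CSeries_eps g s) H eps Heps) as [N HN].
    exists N; intros m Hm. specialize (HN m Hm).
    eapply Rle_lt_trans; [|exact HN].
    eapply Rle_trans; [|apply Rmax_Cmod]. apply Rmax_l.
Qed.

Lemma is_CSeries_snd (g : nat -> C) (s : C) : is_CSeries g s -> is_series (fun k => snd (g k)) (snd s).
Proof.
  intros H. apply (filterlim_ext (fun m => snd (sum_n g m))).
  - induction x as [|m IH]; [rewrite !sum_O; reflexivity|].
    rewrite !sum_Sn, <- IH; reflexivity.
  - apply filterlim_locally_ball_norm; intros [eps Heps].
    destruct (proj1 (is_CSeries_eps g s) H eps Heps) as [N HN].
    exists N; intros m Hm. specialize (HN m Hm).
    eapply Rle_lt_trans; [|exact HN].
    eapply Rle_trans; [|apply Rmax_Cmod]. apply Rmax_r.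
Qed.

(** A total function; its value means something only for convergent series, through [CSeries_eq]. *)
Definition CSeries (g : nat -> C) : C :=
  (Series (fun k => fst (g k)), Series (fun k => snd (g k))).

Lemma CSeries_eq (g : nat -> C) (s : C) : is_CSeries g s -> CSeries g = s.
Proof.
  intros H. unfold CSeries.
  rewrite (is_series_unique _ _ (is_CSeries_fst g s H)), (is_series_unique _ _ (is_CSeries_snd g s H)).
  symmetry; apply surjective_pairing.
Qed.

Definition CPSeries (a : nat -> C) (z : C) : C := CSeries (fun k => a k * z ^ k)%C.

(* Equivalent to convergence of the power series on the whole open unit disc. *)
Definition disc_coefs (a : nat -> C) : Prop :=
  forall r, 0 <= r < 1 -> exists M, forall k, Cmod (a k) * r ^ k <= M.

(** The form in which ratio tests enter: it serves [k q^k] and the binomial coefficients. *)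
Lemma bounded_of_eventually_decreasing (t : nat -> R) (N : nat) :
  (forall k, 0 <= t k) -> (forall k, (N <= k)%nat -> t (S k) <= t k) ->
  exists M, forall k, t k <= M.
Proof.
  revert t; induction N as [|N IH]; intros t H0 H.
  - exists (t 0%nat). induction k as [|k IHk]; [lra|].
    eapply Rle_trans; [apply H; lia|exact IHk].
  - destruct (IH (fun k => t (S k))) as [M HM].
    + intros; apply H0.
    + intros k Hk; apply H; lia.
    + exists (t 0%nat + M). intros [|k].
      * specialize (HM 0%nat); pose proof (H0 1%nat); lra.
      * specialize (HM k); pose proof (H0 0%nat); lra.
Qed.

Lemma is_CSeries_terms_bounded (g : nat -> C) (s : C) :
  is_CSeries g s -> exists M, forall k, Cmod (g k) <= M.
Proof.
  intros H.
  destruct (proj1 (is_CSeries_eps g s) H 1 ltac:(lra)) as [N HN].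
  (* A term is the difference of two consecutive partial sums, each within 1 of [s]. *)
  assert (Ht : forall k, (S N <= k)%nat -> Cmod (g k) <= 2).
  { intros [|k] Hk; [lia|].
    replace (g (S k)) with ((sum_n g (S k) - s) - (sum_n g k - s))%C.
    - unfold Cminus at 1. eapply Rle_trans; [apply Cmod_triangle|].
      rewrite Cmod_opp. pose proof (HN (S k) ltac:(lia)).
      pose proof (HN k ltac:(lia)). lra.
    - rewrite sum_Sn. change (plus (sum_n g k) (g (S k))) with (sum_n g k + g (S k))%C. ring. }
  clear H HN. revert Ht. generalize (S N); clear N; intro N.
  revert g; induction N as [|N IH]; intros g Ht.
  - exists 2; intros k; apply Ht; lia.
  - destruct (IH (fun k => g (S k))) as [M HM]; [intros k Hk; apply Ht; lia|].
    exists (Rmax (Cmod (g 0%nat)) M). intros [|k]; [apply Rmax_l|].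
    eapply Rle_trans; [apply HM|apply Rmax_r].
Qed.

Lemma disc_coefs_of_convergent (a : nat -> C) :
  (forall z, Cmod z < 1 -> exists s, is_CSeries (fun k => a k * z ^ k)%C s) -> disc_coefs a.
Proof.
  intros H r Hr.
  destruct (H (RtoC r)) as [s Hs].
  { rewrite Cmod_R, Rabs_pos_eq; lra. }
  destruct (is_CSeries_terms_bounded _ _ Hs) as [M HM].
  exists M; intros k. specialize (HM k).
  rewrite Cmod_mult, Cmod_pow, Cmod_R, Rabs_pos_eq in HM; lra.
Qed.

(** Boundedness at a radius [r1] strictly between [r] and 1 gives comparison with a geometric series
    of ratio [r / r1]. *)
Lemma disc_coefs_ex_series (a : nat -> C) (r : R) :
  disc_coefs a -> 0 <= r < 1 -> ex_series (fun k => Cmod (a k) * r ^ k).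
Proof.
  intros Ha Hr.
  set (r1 := (1 + r) / 2). assert (Hr1 : 0 < r1 < 1) by (unfold r1; lra).
  assert (Hlt : r < r1) by (unfold r1; lra).
  destruct (Ha r1 ltac:(lra)) as [M HM].
  apply (ex_series_le (K := R_AbsRing) (V := R_CompleteNormedModule) _ (fun k => M * (r / r1) ^ k)).
  - intros k. change (Rabs (Cmod (a k) * r ^ k) <= M * (r / r1) ^ k).
    rewrite Rabs_pos_eq.
    2:{ apply Rmult_le_pos; [apply Cmod_ge_0|apply pow_le; lra]. }
    replace (r ^ k) with (r1 ^ k * (r / r1) ^ k).
    2:{ rewrite <- Rpow_mult_distr; f_equal; field; lra. }
    rewrite <- Rmult_assoc. apply Rmult_le_compat_r; [|apply HM].
    apply pow_le. apply Rdiv_le_0_compat; lra.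
  - apply (ex_series_scal (V := R_NormedModule) M). apply ex_series_geom.
    assert (r / r1 < 1) by (apply Rlt_div_l; lra).
    assert (0 <= r / r1) by (apply Rdiv_le_0_compat; lra).
    rewrite Rabs_pos_eq; lra.
Qed.

Lemma CPSeries_correct (a : nat -> C) (z : C) :
  disc_coefs a -> Cmod z < 1 -> is_CSeries (fun k => a k * z ^ k)%C (CPSeries a z).
Proof.
  intros Ha Hz.
  destruct (is_CSeries_ex (fun k => a k * z ^ k)%C (fun k => Cmod (a k) * Cmod z ^ k)) as [s Hs].
  - intros k. rewrite Cmod_mult, Cmod_pow; lra.
  - apply disc_coefs_ex_series; [exact Ha|]. split; [apply Cmod_ge_0|exact Hz].
  - unfold CPSeries. rewrite (CSeries_eq _ s Hs). exact Hs.
Qed.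

Lemma CPSeries_unique (a : nat -> C) (z s : C) : is_CSeries (fun k => a k * z ^ k)%C s -> CPSeries a z = s.
Proof. apply CSeries_eq. Qed.

(** Allows division by [r] later on: a bound at the larger radius [(1 + r) / 2] also covers
    [r = 0]. *)
Lemma disc_coefs_mono (a : nat -> C) :
  (forall r, 0 < r < 1 -> exists M, forall k, Cmod (a k) * r ^ k <= M) -> disc_coefs a.
Proof.
  intros H r Hr. destruct (H ((1 + r) / 2)) as [M HM]; [lra|].
  exists M; intros k. eapply Rle_trans; [|apply HM].
  apply Rmult_le_compat_l; [apply Cmod_ge_0|]. apply pow_incr; lra.
Qed.

Lemma disc_coefs_shift (a : nat -> C) : disc_coefs a -> disc_coefs (fun k => a (S k)).
Proof.
  intros Ha. apply disc_coefs_mono; intros r Hr.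
  destruct (Ha r ltac:(lra)) as [M HM]. exists (M / r); intros k.
  apply (proj1 (Rle_div_r _ _ r ltac:(lra))). specialize (HM (S k)). simpl in HM. lra.
Qed.

Lemma linear_geometric_bounded (q : R) : 0 < q < 1 -> exists M, forall k, INR k * q ^ k <= M.
Proof.
  intros Hq.
  (* [(k + 1) q <= k] holds exactly when [k >= q / (1 - q)]; the terms decrease from there on. *)
  destruct (nfloor_ex (q / (1 - q))) as [N HN]; [apply Rdiv_le_0_compat; lra|].
  apply (bounded_of_eventually_decreasing (fun k => INR k * q ^ k) (S N)).
  - intros k. apply Rmult_le_pos; [apply pos_INR|apply pow_le; lra].
  - intros k Hk. apply le_INR in Hk. rewrite S_INR in *. simpl.
    rewrite <- Rmult_assoc. apply Rmult_le_compat_r; [apply pow_le; lra|].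
    assert (q / (1 - q) <= INR k) by lra.
    apply Rle_div_l in H; nra.
Qed.

(** The linear factor is absorbed by [(r / r1)^k], where [r < r1 < 1]. *)
Lemma disc_coefs_INR (a : nat -> C) : disc_coefs a -> disc_coefs (fun k => RtoC (INR k) * a k)%C.
Proof.
  intros Ha. apply disc_coefs_mono; intros r Hr.
  set (r1 := (1 + r) / 2). assert (Hr1 : 0 < r1 < 1) by (unfold r1; lra).
  assert (Hlt : r < r1) by (unfold r1; lra).
  destruct (Ha r1 ltac:(lra)) as [M HM].
  assert (0 < r / r1) by (apply Rdiv_lt_0_compat; lra).
  destruct (linear_geometric_bounded (r / r1)) as [M' HM'].
  { split; [lra|apply Rlt_div_l; lra]. }
  exists (M' * M); intros k.
  rewrite Cmod_mult, Cmod_R, Rabs_pos_eq by apply pos_INR.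
  replace (r ^ k) with ((r / r1) ^ k * r1 ^ k).
  2:{ rewrite <- Rpow_mult_distr; f_equal; field; lra. }
  replace (INR k * Cmod (a k) * ((r / r1) ^ k * r1 ^ k))
    with ((INR k * (r / r1) ^ k) * (Cmod (a k) * r1 ^ k)) by ring.
  apply Rmult_le_compat; auto.
  - apply Rmult_le_pos; [apply pos_INR|apply pow_le; lra].
  - apply Rmult_le_pos; [apply Cmod_ge_0|apply pow_le; lra].
Qed.

Lemma disc_coefs_scal (c : C) (a : nat -> C) : disc_coefs a -> disc_coefs (fun k => c * a k)%C.
Proof.
  intros Ha r Hr. destruct (Ha r Hr) as [M HM].
  exists (Cmod c * M); intros k. rewrite Cmod_mult, Rmult_assoc.
  apply Rmult_le_compat_l; [apply Cmod_ge_0|apply HM].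
Qed.

Lemma disc_coefs_minus (a b : nat -> C) : disc_coefs a -> disc_coefs b -> disc_coefs (fun k => a k - b k)%C.
Proof.
  intros Ha Hb r Hr. destruct (Ha r Hr) as [M HM], (Hb r Hr) as [M' HM'].
  exists (M + M'); intros k.
  eapply Rle_trans; [|apply Rplus_le_compat; [apply HM|apply HM']].
  rewrite <- Rmult_plus_distr_r. apply Rmult_le_compat_r; [apply pow_le; lra|].
  unfold Cminus. eapply Rle_trans; [apply Cmod_triangle|]. rewrite Cmod_opp; lra.
Qed.

(** * Power series on the unit disc *)

Definition deriv_coef (a : nat -> C) (k : nat) : C := (RtoC (INR (S k)) * a (S k))%C.

Lemma disc_coefs_deriv (a : nat -> C) : disc_coefs a -> disc_coefs (deriv_coef a).
Proof. intros Ha. exact (disc_coefs_shift _ (disc_coefs_INR a Ha)). Qed.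

Lemma CPSeries_prepend (a : nat -> C) (z : C) :
  disc_coefs a -> Cmod z < 1 -> CPSeries a z = (a 0%nat + z * CPSeries (fun k => a (S k)) z)%C.
Proof.
  intros Ha Hz. apply CPSeries_unique.
  replace (a 0%nat) with (a 0%nat * z ^ 0)%C by (simpl; ring).
  apply (is_CSeries_prepend (fun k => a k * z ^ k)%C).
  eapply is_CSeries_ext; [|apply is_CSeries_scal, (CPSeries_correct _ z (disc_coefs_shift a Ha) Hz)].
  intros k; simpl; ring.
Qed.

(** The operator [z d/dz] multiplies coefficients without shifting them, so later identities can be
    compared index by index. *)
Lemma CPSeries_euler (a : nat -> C) (z : C) :
  disc_coefs a -> Cmod z < 1 -> (z * CPSeries (deriv_coef a) z)%C = CPSeries (fun k => RtoC (INR k) * a k)%C z.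
Proof.
  intros Ha Hz. rewrite (CPSeries_prepend (fun k => RtoC (INR k) * a k)%C z (disc_coefs_INR a Ha) Hz).
  unfold deriv_coef. change (INR 0) with 0. ring.
Qed.

Lemma CPSeries_scal (c : C) (a : nat -> C) (z : C) :
  disc_coefs a -> Cmod z < 1 -> CPSeries (fun k => c * a k)%C z = (c * CPSeries a z)%C.
Proof.
  intros Ha Hz. apply CPSeries_unique.
  eapply is_CSeries_ext; [|apply is_CSeries_scal, (CPSeries_correct a z Ha Hz)]. intros k; simpl; ring.
Qed.

Lemma CPSeries_minus (a b : nat -> C) (z : C) :
  disc_coefs a -> disc_coefs b -> Cmod z < 1 -> CPSeries (fun k => a k - b k)%C z = (CPSeries a z - CPSeries b z)%C.
Proof.
  intros Ha Hb Hz. apply CPSeries_unique.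
  eapply is_CSeries_ext; [|exact (is_CSeries_minus _ _ _ _ (CPSeries_correct a z Ha Hz) (CPSeries_correct b z Hb Hz))].
  intros k; simpl; ring.
Qed.

Lemma CPSeries_0 (a : nat -> C) : disc_coefs a -> CPSeries a 0 = a 0%nat.
Proof. intros Ha. rewrite CPSeries_prepend by first [exact Ha | rewrite Cmod_0; lra]. ring. Qed.

(** * Second-order Taylor expansions *)

(** The remainder is cubic because it must lose, in the maximum principle, against a quadratic gain
    [eps s^2]; [cderiv] is also read off from it. *)
Definition jet2 (F : C -> C) (z A B : C) : Prop :=
  exists K d, 0 < d /\ forall h, Cmod h < d ->
    Cmod (F (z + h) - F z - A * h - B * (h * h))%C <= K * Cmod h ^ 3.

(** [pow_d1] is the derivative of [z^k] and [pow_d2] half its second derivative. The product-rule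
    recursion matches the induction on [k] in the Taylor bounds. *)
Fixpoint pow_d1 (z : C) (k : nat) : C :=
  match k with O => RtoC 0 | S k' => (z ^ k' + z * pow_d1 z k')%C end.
Fixpoint pow_d2 (z : C) (k : nat) : C :=
  match k with O => RtoC 0 | S k' => (pow_d1 z k' + z * pow_d2 z k')%C end.

Lemma pow_d1_S (z : C) (k : nat) : pow_d1 z (S k) = (RtoC (INR (S k)) * z ^ k)%C.
Proof.
  induction k as [|k IH]; [simpl; ring|].
  rewrite S_INR, RtoC_plus.
  change (pow_d1 z (S (S k))) with (z ^ S k + z * pow_d1 z (S k))%C.
  rewrite IH. change (z ^ S k)%C with (z * z ^ k)%C. ring.
Qed.

(** Cauchy-type estimates obtained by induction. The [2 d] in [S] is what the remainder needs: its
    recursion gives [(|z| + d) S^k / d^3 + S^k / d^2 = S^(k+1) / d^3]. *)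
Lemma pow_taylor_bounds (z h : C) (d : R) (k : nat) :
  0 < d -> Cmod h <= d ->
  let S := Cmod z + 2 * d in
  Cmod (pow_d1 z k) <= S ^ k / d /\ Cmod (pow_d2 z k) <= S ^ k / d ^ 2 /\
  Cmod ((z + h) ^ k - z ^ k - pow_d1 z k * h - pow_d2 z k * (h * h))%C
    <= S ^ k / d ^ 3 * Cmod h ^ 3.
Proof.
  intros Hd Hh S. pose proof (Cmod_ge_0 z) as Hz. pose proof (Cmod_ge_0 h) as Hh0.
  assert (Hzk : forall k, Cmod z ^ k <= S ^ k) by (intros; apply pow_incr; unfold S; lra).
  induction k as [|k [IH1 [IH2 IH3]]].
  - cbn [pow_d1 pow_d2 Cpow pow].
    assert (forall m, 0 <= 1 / d ^ m) by
      (intros; apply Rdiv_le_0_compat; [lra|apply pow_lt; lra]).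
    rewrite !Cmod_0. pose proof (H 1%nat). pose proof (H 2%nat). pose proof (H 3%nat).
    replace (1 / d ^ 1) with (1 / d) in * by (field; lra).
    split; [lra|]. split; [exact H1|].
    match goal with |- Cmod ?x <= _ => replace x with (RtoC 0) by ring end.
    rewrite Cmod_0. apply Rmult_le_pos; [exact H2|].
    apply (pow_le (Cmod h) 3); lra.
  - set (P := S ^ k) in *.
    assert (HP : 0 <= P) by (apply pow_le; unfold S; lra).
    assert (HSk : S ^ Datatypes.S k = S * P) by reflexivity. rewrite HSk.
    specialize (Hzk k). fold P in Hzk.
    (* Naming the successive quotients by [d] turns all three bounds into polynomial inequalities
       for [nra]. *)
    set (X := P / d) in *.
    assert (HX : P = X * d) by (unfold X; field; lra).
    replace (P / d ^ 2) with (X / d) in * by (unfold X; field; lra).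
    set (Y := X / d) in *.
    assert (HY : X = Y * d) by (unfold Y; field; lra).
    replace (P / d ^ 3) with (Y / d) in * by (unfold Y, X; field; lra).
    set (W := Y / d) in *.
    assert (HW : Y = W * d) by (unfold W; field; lra).
    replace (S * P / d) with (S * X) by (unfold X; field; lra).
    replace (S * P / d ^ 2) with (S * Y) by (unfold Y, X; field; lra).
    replace (S * P / d ^ 3) with (S * W) by (unfold W, Y, X; field; lra).
    clearbody P X Y W.
    assert (0 <= X) by nra. assert (0 <= Y) by nra. assert (0 <= W) by nra.
    split; [|split].
    + cbn [pow_d1]. eapply Rle_trans; [apply Cmod_triangle|].
      rewrite Cmod_mult, Cmod_pow. unfold S.
      pose proof (Rmult_le_compat_l _ _ _ Hz IH1). nra.
    + cbn [pow_d2]. eapply Rle_trans; [apply Cmod_triangle|].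
      rewrite Cmod_mult. unfold S.
      pose proof (Rmult_le_compat_l _ _ _ Hz IH2). nra.
    (* The remainder for [k + 1] is [z + h] times the remainder for [k], plus the cubic term thrown
       out by [pow_d2]. *)
    + match goal with |- Cmod ?x <= _ => replace x with
        ((z + h) * ((z + h) ^ k - z ^ k - pow_d1 z k * h - pow_d2 z k * (h * h))
          + pow_d2 z k * (h * h * h))%C end.
      2:{ cbn [pow_d1 pow_d2 Cpow]. ring. }
      eapply Rle_trans; [apply Cmod_triangle|]. rewrite !Cmod_mult.
      pose proof (Cmod_triangle z h) as Ht.
      set (q := Cmod h ^ 3) in *.
      replace (Cmod h * Cmod h * Cmod h) with q by (unfold q; ring).
      assert (0 <= q) by (apply pow_le; lra).
      assert (Cmod (pow_d2 z k) * q <= Y * q) by (apply Rmult_le_compat_r; auto).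
      assert (HA : Cmod (z + h) * Cmod ((z + h) ^ k - z ^ k - pow_d1 z k * h - pow_d2 z k * (h * h))
              <= (Cmod z + d) * (W * q)).
      { apply Rmult_le_compat; try apply Cmod_ge_0; auto; lra. }
      unfold S. rewrite HW in *. nra.
Qed.

(** Sums the expansions of the monomials; the bounds are uniform enough because [sum |a_k| S^k]
    converges. *)
Lemma CPSeries_jet2 (a : nat -> C) (z : C) :
  disc_coefs a -> Cmod z < 1 -> exists B, jet2 (CPSeries a) z (CPSeries (deriv_coef a) z) B.
Proof.
  intros Ha Hz. pose proof (Cmod_ge_0 z) as Hz0.
  (* Makes [S = |z| + 2 d] the midpoint of [|z|] and 1. *)
  set (d := (1 - Cmod z) / 4). assert (Hd : 0 < d) by (unfold d; lra).
  set (S := Cmod z + 2 * d). assert (HS : 0 <= S < 1) by (unfold S, d; lra).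
  pose proof (disc_coefs_ex_series a S Ha HS) as HsS.
  assert (HsS' : forall c, ex_series (fun k => c * (Cmod (a k) * S ^ k))).
  { intros c. apply (ex_series_scal (V := R_NormedModule) c _ HsS). }
  assert (Hd1 : is_CSeries (fun k => a k * pow_d1 z k)%C (CPSeries (deriv_coef a) z)).
  { replace (CPSeries (deriv_coef a) z) with (a 0%nat * pow_d1 z 0 + CPSeries (deriv_coef a) z)%C
      by (simpl; ring).
    apply (is_CSeries_prepend (fun k => a k * pow_d1 z k)%C).
    eapply is_CSeries_ext; [|apply (CPSeries_correct _ z (disc_coefs_deriv a Ha) Hz)].
    intros k; cbv beta. rewrite pow_d1_S. unfold deriv_coef. ring. }
  destruct (is_CSeries_ex (fun k => a k * pow_d2 z k)%C (fun k => / d ^ 2 * (Cmod (a k) * S ^ k)))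
    as [B HB].
  { intros k. rewrite Cmod_mult.
    destruct (pow_taylor_bounds z 0 d k Hd) as [_ [H2 _]]; [rewrite Cmod_0; lra|].
    fold S in H2. replace (/ d ^ 2 * (Cmod (a k) * S ^ k)) with (Cmod (a k) * (S ^ k / d ^ 2))
      by (field; lra).
    apply Rmult_le_compat_l; [apply Cmod_ge_0|exact H2]. }
  { apply HsS'. }
  exists B, (Series (fun k => / d ^ 3 * (Cmod (a k) * S ^ k))), d. split; [exact Hd|].
  intros h Hh.
  assert (Hzh : Cmod (z + h) < 1).
  { eapply Rle_lt_trans; [apply Cmod_triangle|]. unfold d in Hh; lra. }
  rewrite Rmult_comm, <- Series_scal_l.
  apply (is_CSeries_bound (fun k => a k * ((z + h) ^ k - z ^ k - pow_d1 z k * h - pow_d2 z k * (h * h)))%C).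
  - intros k. rewrite Cmod_mult.
    destruct (pow_taylor_bounds z h d k Hd) as [_ [_ H3]]; [lra|]. fold S in H3.
    replace (Cmod h ^ 3 * (/ d ^ 3 * (Cmod (a k) * S ^ k)))
      with (Cmod (a k) * (S ^ k / d ^ 3 * Cmod h ^ 3)) by (field; lra).
    apply Rmult_le_compat_l; [apply Cmod_ge_0|exact H3].
  - apply (ex_series_scal (V := R_NormedModule) (Cmod h ^ 3)). apply HsS'.
  - pose proof (CPSeries_correct a z Ha Hz) as H0.
    pose proof (CPSeries_correct a (z + h)%C Ha Hzh) as H1.
    replace (CPSeries (deriv_coef a) z * h)%C with (h * CPSeries (deriv_coef a) z)%C by ring.
    replace (B * (h * h))%C with ((h * h) * B)%C by ring.
    eapply is_CSeries_ext; [|exact (is_CSeries_minus _ _ _ _ (is_CSeries_minus _ _ _ _ (is_CSeries_minus _ _ _ _ H1 H0)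
      (is_CSeries_scal h _ _ Hd1)) (is_CSeries_scal (h * h)%C _ _ HB))].
    intros k; simpl; ring.
Qed.

(** Normalises the constants so that higher powers of [|h|] are bounded by lower ones. *)
Lemma jet2_weaken (F : C -> C) (z A B : C) :
  jet2 F z A B -> exists K d, 0 < d <= 1 /\ 0 <= K /\ forall h, Cmod h < d ->
    Cmod (F (z + h) - F z - A * h - B * (h * h))%C <= K * Cmod h ^ 3.
Proof.
  intros [K [d [Hd H]]]. exists (Rmax 0 K), (Rmin 1 d).
  split; [|split].
  - split; [apply Rmin_glb_lt; lra|apply Rmin_l].
  - apply Rmax_l.
  - intros h Hh. eapply Rle_trans; [apply H|].
    + eapply Rlt_le_trans; [exact Hh|apply Rmin_r].
    + apply Rmult_le_compat_r; [apply pow_le, Cmod_ge_0|apply Rmax_r].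
Qed.

Lemma jet2_lipschitz (F : C -> C) (z A B : C) :
  jet2 F z A B -> exists L d, 0 < d /\ 0 <= L /\ forall h, Cmod h < d ->
    Cmod (F (z + h) - F z)%C <= L * Cmod h.
Proof.
  intros H. destruct (jet2_weaken F z A B H) as [K [d [Hd [HK H']]]].
  exists (Cmod A + Cmod B + K), d. pose proof (Cmod_ge_0 A). pose proof (Cmod_ge_0 B).
  split; [lra|]. split; [lra|]. intros h Hh. specialize (H' h Hh).
  pose proof (Cmod_ge_0 h).
  replace (F (z + h) - F z)%C with
    ((F (z + h) - F z - A * h - B * (h * h)) + (A * h + B * (h * h)))%C by ring.
  eapply Rle_trans; [apply Cmod_triangle|].
  pose proof (Cmod_triangle (A * h) (B * (h * h))) as HT. rewrite !Cmod_mult in HT.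
  set (x := Cmod h) in *. assert (x * x <= x) by nra.
  assert (x ^ 3 <= x) by (simpl; nra).
  assert (K * x ^ 3 <= K * x) by (apply Rmult_le_compat_l; lra).
  assert (Cmod B * (x * x) <= Cmod B * x) by (apply Rmult_le_compat_l; lra).
  lra.
Qed.

(** Agreement is asked only near [z], since [f] equals its series only inside the disc. *)
Lemma jet2_cderiv (F f : C -> C) (z A B : C) (d0 : R) :
  0 < d0 -> (forall h, Cmod h < d0 -> f (z + h)%C = F (z + h)%C) ->
  jet2 F z A B -> cderiv f z A.
Proof.
  intros Hd0 Hf H. destruct (jet2_weaken F z A B H) as [K [d [Hd [HK H']]]].
  intros eps Heps. pose proof (Cmod_ge_0 B).
  set (L := Cmod B + K + 1).
  assert (Hde : 0 < eps / L) by (apply Rdiv_lt_0_compat; unfold L; lra).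
  exists (Rmin (Rmin d d0) (eps / L)). split; [repeat apply Rmin_glb_lt; lra|].
  intros h. rewrite !Cnorm_Cmod, Cdiv_Cdiv. intros [Hh0 Hh].
  pose proof (Rmin_l (Rmin d d0) (eps / L)). pose proof (Rmin_r (Rmin d d0) (eps / L)).
  pose proof (Rmin_l d d0). pose proof (Rmin_r d d0).
  assert (Hnz : h <> RtoC 0) by (apply Cmod_gt_0; exact Hh0).
  change (Cmod ((f (z + h) - f z) / h - A)%C < eps).
  rewrite Hf by lra.
  assert (Hfz : f z = F z).
  { specialize (Hf (RtoC 0)). rewrite Cplus_0_r in Hf. apply Hf. rewrite Cmod_0; lra. }
  rewrite Hfz. specialize (H' h ltac:(lra)).
  replace ((F (z + h) - F z) / h - A)%C with
    ((F (z + h) - F z - A * h - B * (h * h)) / h + B * h)%C by (field; exact Hnz).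
  eapply Rle_lt_trans; [apply Cmod_triangle|].
  rewrite Cmod_div, Cmod_mult by exact Hnz.
  set (x := Cmod h) in *.
  assert (Cmod (F (z + h) - F z - A * h - B * (h * h))%C / x <= K * x).
  { apply (proj2 (Rle_div_l _ _ x ltac:(lra))). eapply Rle_trans; [exact H'|].
    replace (K * x * x) with (K * (x * x)) by ring.
    apply Rmult_le_compat_l; [exact HK|]. assert (x <= 1) by lra. simpl. nra. }
  assert (x < eps / L) by lra.
  apply (proj2 (Rlt_div_r _ _ L ltac:(unfold L; lra))) in H6. unfold L in H6. nra.
Qed.

(** Makes [Qf_val] single-valued, so that any derivative witness can be replaced by the series of
    [deriv_coef]. *)
Lemma cderiv_unique (f : C -> C) (z l1 l2 : C) : cderiv f z l1 -> cderiv f z l2 -> l1 = l2.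
Proof.
  intros H1 H2. apply NNPP; intros Hne.
  assert (He : 0 < Cmod (l1 - l2)) by (apply Cmod_gt_0, Cminus_eq_contra, Hne).
  destruct (H1 (Cmod (l1 - l2) / 2)) as [d1 [Hd1 H1']]; [lra|].
  destruct (H2 (Cmod (l1 - l2) / 2)) as [d2 [Hd2 H2']]; [lra|].
  set (h := RtoC (Rmin d1 d2 / 2)).
  assert (Hm : 0 < Rmin d1 d2) by (apply Rmin_glb_lt; lra).
  pose proof (Rmin_l d1 d2). pose proof (Rmin_r d1 d2).
  assert (Hh : Cmod h = Rmin d1 d2 / 2).
  { unfold h; rewrite Cmod_R, Rabs_pos_eq; lra. }
  specialize (H1' h). specialize (H2' h). rewrite !Cnorm_Cmod, Hh in *.
  specialize (H1' ltac:(lra)). specialize (H2' ltac:(lra)).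
  set (q := Defs.Cdiv (Defs.Csub (f (Defs.Cadd z h)) (f z)) h) in *.
  change (Cmod ((q : C) - l1) < Cmod (l1 - l2) / 2) in H1'.
  change (Cmod ((q : C) - l2) < Cmod (l1 - l2) / 2) in H2'.
  assert (Cmod (l1 - l2) <= Cmod ((q:C) - l2) + Cmod ((q:C) - l1)).
  { rewrite (Cmod_minus_sym q l1). eapply Rle_trans; [|apply Cmod_triangle].
    right; f_equal; ring. }
  lra.
Qed.

Lemma jet2_div (N D : C -> C) (z A B A' B' : C) :
  jet2 N z A B -> jet2 D z A' B' -> D z <> RtoC 0 ->
  exists b c, jet2 (fun u => N u / D u)%C z b c.
Proof.
  intros HN HD Hz.
  destruct (jet2_lipschitz D z A' B' HD) as [L [dL [HdL [HL HLip]]]].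
  destruct (jet2_weaken N z A B HN) as [K1 [d1 [Hd1 [HK1 H1]]]].
  destruct (jet2_weaken D z A' B' HD) as [K2 [d2 [Hd2 [HK2 H2]]]].
  pose proof (proj1 (Cmod_gt_0 _) Hz) as Hm. set (m := Cmod (D z)) in *.
  set (G := (N z / D z)%C).
  (* [b] and [c] solve [N = (G + b h + c h^2) D] up to second order; [K] collects what remains from
     order three on. *)
  set (b := ((A - G * A') / D z)%C).
  set (c := ((B - G * B' - b * A') / D z)%C).
  pose proof (Cmod_ge_0 G). pose proof (Cmod_ge_0 b). pose proof (Cmod_ge_0 c).
  pose proof (Cmod_ge_0 A'). pose proof (Cmod_ge_0 B').
  set (K := K1 + (Cmod G + Cmod b + Cmod c) * K2 + (Cmod b * Cmod B' + Cmod c * Cmod A')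
            + Cmod c * Cmod B').
  (* The radius [m / (2 (L + 1))] keeps [|D (z + h)| >= m / 2], whence the factor [2 / m]. *)
  exists b, c, (2 / m * K), (Rmin (Rmin dL (m / (2 * (L + 1)))) (Rmin d1 d2)).
  assert (Hml : 0 < m / (2 * (L + 1))) by (apply Rdiv_lt_0_compat; lra).
  split; [repeat apply Rmin_glb_lt; lra|].
  intros h Hh.
  assert (Hh1 : Cmod h < dL) by (eapply Rlt_le_trans; [exact Hh|]; eapply Rle_trans; [apply Rmin_l|apply Rmin_l]).
  assert (Hh2 : Cmod h < m / (2 * (L + 1))) by (eapply Rlt_le_trans; [exact Hh|]; eapply Rle_trans; [apply Rmin_l|apply Rmin_r]).
  assert (Hh3 : Cmod h < d1) by (eapply Rlt_le_trans; [exact Hh|]; eapply Rle_trans; [apply Rmin_r|apply Rmin_l]).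
  assert (Hh4 : Cmod h < d2) by (eapply Rlt_le_trans; [exact Hh|]; eapply Rle_trans; [apply Rmin_r|apply Rmin_r]).
  clear Hh. specialize (HLip h Hh1). specialize (H1 h Hh3). specialize (H2 h Hh4).
  pose proof (Cmod_ge_0 h) as Hx0.
  apply (proj2 (Rlt_div_r _ _ (2 * (L + 1)) ltac:(lra))) in Hh2.
  assert (HDm : m / 2 <= Cmod (D (z + h)%C)).
  { assert (m <= Cmod (D (z + h)%C) + Cmod (D (z + h) - D z)%C).
    { rewrite Cmod_minus_sym. unfold m. eapply Rle_trans; [|apply Cmod_triangle].
      right; f_equal; ring. }
    nra. }
  assert (HDnz : D (z + h)%C <> RtoC 0) by (apply Cmod_gt_0; lra).
  set (eN := (N (z + h) - N z - A * h - B * (h * h))%C) in *.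
  set (eD := (D (z + h) - D z - A' * h - B' * (h * h))%C) in *.
  replace (N (z + h) / D (z + h) - N z / D z - b * h - c * (h * h))%C with
    ((eN - (G + b * h + c * (h * h)) * eD - (b * B' + c * A') * (h * h * h)
       - c * B' * (h * h * h * h)) / D (z + h))%C.
  2:{ unfold eN, eD, c, b, G. field. split; assumption. }
  rewrite Cmod_div by exact HDnz.
  apply (proj2 (Rle_div_l _ _ (Cmod (D (z + h)%C)) ltac:(lra))).
  assert (Hx1 : Cmod h < 1) by lra.
  assert (HT : forall u v : C, Cmod (u - v) <= Cmod u + Cmod v).
  { intros u v. unfold Cminus. rewrite <- (Cmod_opp v). apply Cmod_triangle. }
  set (x := Cmod h) in *.
  assert (HK : 0 <= K).
  { unfold K. repeat apply Rplus_le_le_0_compat; repeat apply Rmult_le_pos;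
    repeat apply Rplus_le_le_0_compat; try apply Rmult_le_pos; lra. }
  assert (Hx3 : 0 <= x ^ 3) by (apply pow_le; lra).
  apply Rle_trans with (K * x ^ 3).
  2:{ replace (K * x ^ 3) with (2 / m * K * x ^ 3 * (m / 2)) by (field; lra).
      apply Rmult_le_compat_l; [|exact HDm].
      repeat apply Rmult_le_pos; auto; try lra.
      left; apply Rinv_0_lt_compat; lra. }
  eapply Rle_trans; [apply HT|]. eapply Rle_trans; [apply Rplus_le_compat_r, HT|].
  eapply Rle_trans; [apply Rplus_le_compat_r, Rplus_le_compat_r, HT|].
  rewrite !Cmod_mult. fold x.
  assert (Hg : Cmod (G + b * h + c * (h * h)) <= Cmod G + Cmod b + Cmod c).
  { eapply Rle_trans; [apply Cmod_triangle|].
    eapply Rle_trans; [apply Rplus_le_compat_r, Cmod_triangle|].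
    rewrite !Cmod_mult. fold x. assert (x * x <= 1) by nra. nra. }
  assert (Hg2 : Cmod (b * B' + c * A') <= Cmod b * Cmod B' + Cmod c * Cmod A').
  { eapply Rle_trans; [apply Cmod_triangle|]. rewrite !Cmod_mult; lra. }
  replace (x * x * x * x) with (x ^ 3 * x) by ring.
  replace (x * x * x) with (x ^ 3) by ring.
  assert (E1 : Cmod (G + b * h + c * (h * h)) * Cmod eD
    <= (Cmod G + Cmod b + Cmod c) * (K2 * x ^ 3)).
  { apply Rmult_le_compat; auto using Cmod_ge_0. }
  assert (E2 : Cmod (b * B' + c * A') * x ^ 3 <= (Cmod b * Cmod B' + Cmod c * Cmod A') * x ^ 3).
  { apply Rmult_le_compat_r; auto. }
  assert (E3 : Cmod c * Cmod B' * (x ^ 3 * x) <= Cmod c * Cmod B' * x ^ 3).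
  { apply Rmult_le_compat_l; [apply Rmult_le_pos; auto|]. nra. }
  unfold K. lra.
Qed.

(** * Maximum principle *)

(** Compactness of the square around the disc. The local hypothesis therefore ranges over all [p],
    including points outside the disc, near which there may be no [q] to test. *)
Lemma disc_local_to_uniform (r : R) (P : R -> C -> Prop) :
  (forall d d' q, d' <= d -> P d q -> P d' q) ->
  (forall p : C, exists d, 0 < d /\ forall q, Cmod q <= r -> Cmod (q - p)%C < d -> P d q) ->
  exists d, 0 < d /\ forall q, Cmod q <= r -> P d q.
Proof.
  intros Hmono Hloc.
  (* The cover is by sup-norm boxes, so the gauge is halved to absorb the factor [sqrt 2 <= 2]. *)
  assert (Hd : forall u v : R, {d : posreal |
     forall q, Cmod q <= r -> Cmod (q - (u, v))%C < 2 * d -> P d q}).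
  { intros u v. apply constructive_indefinite_description.
    destruct (Hloc (u, v)) as [d [Hd H]].
    exists (mkposreal (d / 2) ltac:(lra)). simpl. intros q Hq Hqp.
    apply (Hmono d); [lra|]. apply H; [exact Hq|lra]. }
  destruct (compactness_value_2d (-r) r (-r) r (fun u v => proj1_sig (Hd u v))) as [d H].
  exists d; split; [apply cond_pos|]. intros q Hq.
  (* [compactness_value_2d] yields its covering point only under a double negation, so the goal is
     proved by contradiction. *)
  apply NNPP; intros HP. pose proof (Rmax_Cmod q) as Hm.
  pose proof (Rmax_l (Rabs (fst q)) (Rabs (snd q))).
  pose proof (Rmax_r (Rabs (fst q)) (Rabs (snd q))).
  apply (H (fst q) (snd q)); [apply Rabs_le_between; lra|apply Rabs_le_between; lra|].
  intros [u [v [_ [_ [Hu [Hv Hdd]]]]]]. apply HP.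
  apply (Hmono _ _ _ Hdd).
  destruct (Hd u v) as [e He]; simpl in *. apply He; [exact Hq|].
  eapply Rle_lt_trans; [apply Cmod_2Rmax|].
  change (sqrt 2 * Rmax (Rabs (fst q - u)) (Rabs (snd q - v)) < 2 * e).
  assert (Hs : 0 <= sqrt 2 <= 2).
  { split; [apply sqrt_pos|]. rewrite <- (sqrt_square 2) at 2 by lra. apply sqrt_le_1_alt; lra. }
  assert (Rmax (Rabs (fst q - u)) (Rabs (snd q - v)) < e) by (apply Rmax_lub_lt; assumption).
  pose proof (Rabs_pos (fst q - u)). pose proof (Rmax_l (Rabs (fst q - u)) (Rabs (snd q - v))).
  nra.
Qed.

(** Compactness is used twice: for an upper bound, and, if the supremum [m] were not attained, for a
    uniform gap below [m]. *)
Lemma disc_attains_max (r : R) (Phi : C -> R) :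
  0 <= r ->
  (forall p, Cmod p <= r -> forall eps, 0 < eps -> exists d, 0 < d /\
     forall q, Cmod (q - p)%C < d -> Rabs (Phi q - Phi p) < eps) ->
  exists p, Cmod p <= r /\ forall q, Cmod q <= r -> Phi q <= Phi p.
Proof.
  intros Hr Hc.
  assert (Hout : forall p, r < Cmod p -> forall q, Cmod q <= r -> ~ Cmod (q - p)%C < Cmod p - r).
  { intros p Hp q Hq Hlt.
    assert (Cmod p <= Cmod q + Cmod (q - p)).
    { rewrite Cmod_minus_sym. eapply Rle_trans; [|apply Cmod_triangle]. right; f_equal; ring. }
    lra. }
  (* Encodes [Phi q <= 1 / d]; quantifying over all [e] in [(0, d]] makes it monotone in [d]
     whatever the sign of [Phi q]. *)
  destruct (disc_local_to_uniform r (fun d q => forall e, 0 < e <= d -> e * Phi q <= 1))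
    as [d0 [Hd0 Hb]].
  { intros d d' q Hdd H e He. apply H; lra. }
  { intros p. destruct (Rle_lt_dec (Cmod p) r) as [Hp|Hp].
    - destruct (Hc p Hp 1 ltac:(lra)) as [d [Hd H]].
      pose proof (Rabs_pos (Phi p)) as Ha.
      set (g := / (Rabs (Phi p) + 1)).
      assert (Hg : 0 < g) by (apply Rinv_0_lt_compat; lra).
      exists (Rmin d g). split; [apply Rmin_glb_lt; lra|].
      intros q _ Hq e He. specialize (H q (Rlt_le_trans _ _ _ Hq (Rmin_l _ _))).
      pose proof (Rmin_r d g). apply Rabs_def2 in H. pose proof (Rle_abs (Phi p)).
      assert (Hge : g * (Rabs (Phi p) + 1) = 1) by (unfold g; field; lra).
      destruct (Rle_dec 0 (Phi q)); nra.
    - exists (Cmod p - r). split; [lra|]. intros q Hq Hqp. destruct (Hout p Hp q Hq Hqp). }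
  destruct (completeness (fun y => exists q, Cmod q <= r /\ y = Phi q)) as [m [Hub Hlub]].
  { exists (/ d0). intros y [q [Hq ->]]. specialize (Hb q Hq d0 ltac:(lra)).
    apply (Rmult_le_reg_l d0); [exact Hd0|]. rewrite Rinv_r; lra. }
  { exists (Phi (RtoC 0)), (RtoC 0). rewrite Cmod_0. auto. }
  apply NNPP; intros Hno.
  assert (Hlt : forall p, Cmod p <= r -> Phi p < m).
  { intros p Hp. destruct (Hub (Phi p)) as [H|H]; [exists p; auto|exact H|].
    exfalso; apply Hno. exists p; split; [exact Hp|]. rewrite H.
    intros q Hq. apply Hub; exists q; auto. }
  destruct (disc_local_to_uniform r (fun d q => Phi q <= m - d)) as [d [Hd Hall]].
  { intros d d' q Hdd H. lra. }
  { intros p. destruct (Rle_lt_dec (Cmod p) r) as [Hp|Hp].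
    - specialize (Hlt p Hp).
      destruct (Hc p Hp ((m - Phi p) / 2) ltac:(lra)) as [d [Hd H]].
      exists (Rmin d ((m - Phi p) / 2)). split; [apply Rmin_glb_lt; lra|].
      intros q _ Hq. specialize (H q (Rlt_le_trans _ _ _ Hq (Rmin_l _ _))).
      pose proof (Rmin_r d ((m - Phi p) / 2)). apply Rabs_def2 in H. lra.
    - exists (Cmod p - r). split; [lra|]. intros q Hq Hqp. destruct (Hout p Hp q Hq Hqp). }
  assert (m <= m - d); [|lra]. apply Hlub. intros y [q [Hq ->]]. auto.
Qed.

Lemma Cmod_sqr (z : C) : Cmod z ^ 2 = fst z * fst z + snd z * snd z.
Proof. rewrite Cmod2_alt. unfold Re, Im. ring. Qed.

(* The linear and quadratic terms of the jet cancel in the mean over [h], [-h], [i h], [-i h]. *)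
Lemma four_point_mean (F : C -> C) (z A B : C) :
  jet2 F z A B -> exists K d, 0 < d /\ forall s, 0 < s < d ->
    4 * Cmod (F z) ^ 2 - K * s ^ 3 <=
    Cmod (F (z + (s, 0)%R)%C) ^ 2 + Cmod (F (z + (- s, 0)%R)%C) ^ 2 +
    Cmod (F (z + (0, s)%R)%C) ^ 2 + Cmod (F (z + (0, - s)%R)%C) ^ 2.
Proof.
  intros [K [d [Hd H]]].
  (* Each of the four points loses at most [2 |F z| K s^3], from the cross term with the remainder;
     the square of the increment is nonnegative and dropped. *)
  exists (8 * Cmod (F z) * K), d. split; [exact Hd|]. intros s Hs.
  assert (HT : forall h : C, Cmod h = s ->
    Cmod (F z) ^ 2 + 2 * (fst (F z) * fst (A * h + B * (h * h))%C
                          + snd (F z) * snd (A * h + B * (h * h))%C)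
      - 2 * Cmod (F z) * K * s ^ 3 <= Cmod (F (z + h)%C) ^ 2).
  { intros h Hh. specialize (H h). rewrite Hh in H. specialize (H ltac:(lra)).
    set (e := (F (z + h) - F z - A * h - B * (h * h))%C) in *.
    set (t := (A * h + B * (h * h))%C) in *.
    replace (F (z + h)%C) with (F z + (t + e))%C by (unfold t, e; ring).
    assert (Hre : - (Cmod (F z) * (K * s ^ 3)) <= fst (F z) * fst e + snd (F z) * snd e).
    { assert (Hc : Rabs (Re (F z * Cconj e)%C) <= Cmod (F z) * (K * s ^ 3)).
      { eapply Rle_trans; [apply re_le_Cmod|]. rewrite Cmod_mult, Cmod_conj.
        apply Rmult_le_compat_l; [apply Cmod_ge_0|exact H]. }
      apply Rabs_le_between in Hc. unfold Re, Cconj, Cmult in Hc; simpl in Hc. simpl. lra. }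
    rewrite !Cmod_sqr. change (fst (F z + (t + e))%C) with (fst (F z) + (fst t + fst e)).
    change (snd (F z + (t + e))%C) with (snd (F z) + (snd t + snd e)).
    pose proof (pow2_ge_0 (fst t + fst e)). pose proof (pow2_ge_0 (snd t + snd e)). lra. }
  assert (Hm : forall u v : R, u * u + v * v = s * s -> Cmod (u, v) = s).
  { intros u v E. rewrite <- (sqrt_square s) by lra. rewrite <- E. unfold Cmod; f_equal; simpl; ring. }
  pose proof (HT (s, 0) (Hm s 0 ltac:(ring))) as H1.
  pose proof (HT (- s, 0) (Hm (- s) 0 ltac:(ring))) as H2.
  pose proof (HT (0, s) (Hm 0 s ltac:(ring))) as H3.
  pose proof (HT (0, - s) (Hm 0 (- s) ltac:(ring))) as H4.
  clear H HT Hm.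
  set (F1 := F (z + (s, 0)%R)%C) in *. set (F2 := F (z + (- s, 0)%R)%C) in *.
  set (F3 := F (z + (0, s)%R)%C) in *. set (F4 := F (z + (0, - s)%R)%C) in *.
  clearbody F1 F2 F3 F4. unfold Cmult, Cplus in *. cbn [fst snd] in *. lra.
Qed.

Lemma jet2_continuity (F : C -> C) (z A B : C) :
  jet2 F z A B -> forall e1 eps, 0 < eps -> exists d, 0 < d /\
     forall q, Cmod (q - z)%C < d ->
       Rabs (Cmod (F q) ^ 2 + e1 * Cmod q ^ 2 - (Cmod (F z) ^ 2 + e1 * Cmod z ^ 2)) < eps.
Proof.
  intros HJ e1 eps Heps.
  destruct (jet2_lipschitz F z A B HJ) as [L [d [Hd [HL H]]]].
  pose proof (Cmod_ge_0 (F z)). pose proof (Cmod_ge_0 z). pose proof (Rabs_pos e1).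
  (* A local Lipschitz constant, from [||u|^2 - |v|^2| <= |u - v| (|u - v| + 2 |v|)] applied to both
     summands; the final [+ 1] keeps it positive. *)
  set (T := L * (L + 2 * Cmod (F z)) + Rabs e1 * (1 + 2 * Cmod z) + 1).
  assert (HTpos : 1 <= T) by (unfold T; nra).
  assert (Het : 0 < eps / T) by (apply Rdiv_lt_0_compat; lra).
  exists (Rmin (Rmin 1 d) (eps / T)). split; [repeat apply Rmin_glb_lt; lra|].
  intros q Hq.
  pose proof (Rmin_l (Rmin 1 d) (eps / T)). pose proof (Rmin_r (Rmin 1 d) (eps / T)).
  pose proof (Rmin_l 1 d). pose proof (Rmin_r 1 d).
  set (h := (q - z)%C) in *.
  replace q with (z + h)%C by (unfold h; ring).
  specialize (H h ltac:(lra)). pose proof (Cmod_ge_0 h).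
  assert (Hgen : forall u v : C, Rabs (Cmod u ^ 2 - Cmod v ^ 2)
     <= Cmod (u - v) * (Cmod (u - v) + 2 * Cmod v)).
  { intros u v. pose proof (Cmod_triangle (u - v) v) as T1.
    pose proof (Cmod_triangle (v - u) u) as T2.
    replace (u - v + v)%C with u in T1 by ring.
    replace (v - u + u)%C with v in T2 by ring.
    rewrite (Cmod_minus_sym v u) in T2.
    pose proof (Cmod_ge_0 u). pose proof (Cmod_ge_0 v). pose proof (Cmod_ge_0 (u - v)).
    apply Rabs_le. split; nra. }
  pose proof (Hgen (F (z + h)%C) (F z)) as G1.
  pose proof (Hgen (z + h)%C z) as G2.
  replace (z + h - z)%C with h in G2 by ring.
  assert (G1' : Rabs (Cmod (F (z + h)%C) ^ 2 - Cmod (F z) ^ 2)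
             <= L * Cmod h * (L + 2 * Cmod (F z))).
  { eapply Rle_trans; [exact G1|]. pose proof (Cmod_ge_0 (F (z + h) - F z)%C).
    apply Rmult_le_compat; try lra. nra. }
  assert (G2' : Rabs (e1 * (Cmod (z + h)%C ^ 2 - Cmod z ^ 2))
             <= Rabs e1 * (Cmod h * (1 + 2 * Cmod z))).
  { rewrite Rabs_mult. apply Rmult_le_compat_l; [auto|].
    eapply Rle_trans; [exact G2|]. apply Rmult_le_compat_l; lra. }
  replace (Cmod (F (z + h)%C) ^ 2 + e1 * Cmod (z + h)%C ^ 2 - (Cmod (F z) ^ 2 + e1 * Cmod z ^ 2))
    with ((Cmod (F (z + h)%C) ^ 2 - Cmod (F z) ^ 2) + e1 * (Cmod (z + h)%C ^ 2 - Cmod z ^ 2)) by ring.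
  eapply Rle_lt_trans; [apply Rabs_triang|].
  assert (Hh : Cmod h < eps / T) by lra.
  apply (proj2 (Rlt_div_r _ _ T ltac:(lra))) in Hh. unfold T in Hh. lra.
Qed.

(** At an interior maximum of the perturbed function, the four-point sum gains [4 e s^2] from the
    perturbation and loses at most [K s^3], which is impossible for small [s]. *)
Lemma maximum_principle (F : C -> C) (r M : R) :
  0 < r ->
  (forall z, Cmod z <= r -> exists A B, jet2 F z A B) ->
  (forall z, Cmod z = r -> Cmod (F z) <= M) ->
  forall z, Cmod z <= r -> Cmod (F z) <= M.
Proof.
  intros Hr HJ HM z1 Hz1. apply Rnot_lt_le; intros Hlt.
  assert (HM0 : 0 <= M).
  { eapply Rle_trans; [|apply (HM (RtoC r))]; [apply Cmod_ge_0|].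
    rewrite Cmod_R, Rabs_pos_eq; lra. }
  (* On the circle the perturbation adds only half the excess of [|F z1|^2] over [M^2], so the
     maximum cannot lie there. *)
  set (e := (Cmod (F z1) ^ 2 - M ^ 2) / (2 * r ^ 2)).
  assert (Hr2 : 0 < r ^ 2) by (apply pow_lt; lra).
  assert (He : 0 < e) by (apply Rdiv_lt_0_compat; [simpl; nra|lra]).
  assert (Her : e * r ^ 2 = (Cmod (F z1) ^ 2 - M ^ 2) / 2) by (unfold e; field; lra).
  destruct (disc_attains_max r (fun z => Cmod (F z) ^ 2 + e * Cmod z ^ 2)) as [z0 [Hz0 Hmax]].
  { lra. }
  { intros p Hp eps Heps. destruct (HJ p Hp) as [A [B Hj]].
    exact (jet2_continuity F p A B Hj e eps Heps). }
  assert (Hin : Cmod z0 < r).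
  { destruct Hz0 as [H|H]; [exact H|]. exfalso.
    specialize (Hmax z1 Hz1). specialize (HM z0 H). rewrite H in Hmax.
    pose proof (Cmod_ge_0 (F z0)). pose proof (pow_le (Cmod z1) 2 (Cmod_ge_0 z1)).
    assert (Cmod (F z0) ^ 2 <= M ^ 2) by (apply pow_incr; lra).
    assert (M ^ 2 < Cmod (F z1) ^ 2) by (simpl; nra). nra. }
  destruct (HJ z0 Hz0) as [A [B Hj]].
  destruct (four_point_mean F z0 A B Hj) as [K [d [Hd H4]]].
  set (K' := Rmax 1 K). assert (HK' : 1 <= K') by apply Rmax_l.
  assert (Hek : 0 < e / K') by (apply Rdiv_lt_0_compat; lra).
  (* Small enough for the jet, for staying in the disc, and for [K s < e]. *)
  set (s := Rmin (Rmin d (r - Cmod z0)) (e / K') / 2).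
  assert (Hs0 : 0 < Rmin (Rmin d (r - Cmod z0)) (e / K')) by (repeat apply Rmin_glb_lt; lra).
  pose proof (Rmin_l (Rmin d (r - Cmod z0)) (e / K')).
  pose proof (Rmin_r (Rmin d (r - Cmod z0)) (e / K')).
  pose proof (Rmin_l d (r - Cmod z0)). pose proof (Rmin_r d (r - Cmod z0)).
  assert (Hs : 0 < s) by (unfold s; lra).
  assert (Hsd : s < d) by (unfold s; lra).
  assert (Hsr : s < r - Cmod z0) by (unfold s; lra).
  assert (Hse : s < e / K') by (unfold s; lra).
  specialize (H4 s (conj Hs Hsd)).
  assert (Hm : forall u v : R, u * u + v * v = s * s -> Cmod (u, v) = s).
  { intros u v E. rewrite <- (sqrt_square s) by lra. rewrite <- E. unfold Cmod; f_equal; simpl; ring. }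
  assert (Hq : forall u v : R, u * u + v * v = s * s ->
     Cmod (F (z0 + (u, v)%R)%C) ^ 2 + e * (Cmod z0 ^ 2 + 2 * (fst z0 * u + snd z0 * v) + s ^ 2)
       <= Cmod (F z0) ^ 2 + e * Cmod z0 ^ 2).
  { intros u v E. eapply Rle_trans; [|apply (Hmax (z0 + (u, v)%R)%C)].
    - right. f_equal. f_equal. rewrite !Cmod_sqr. simpl. nra.
    - eapply Rle_trans; [apply Cmod_triangle|]. rewrite (Hm u v E). lra. }
  pose proof (Hq s 0 ltac:(ring)). pose proof (Hq (- s) 0 ltac:(ring)).
  pose proof (Hq 0 s ltac:(ring)). pose proof (Hq 0 (- s) ltac:(ring)).
  assert (HKs : K * s ^ 3 < e * s ^ 2).
  { assert (K <= K') by apply Rmax_r.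
    apply (proj2 (Rlt_div_r _ _ K' ltac:(lra))) in Hse.
    assert (0 < s ^ 2) by (apply pow_lt; lra).
    replace (K * s ^ 3) with (K * s * s ^ 2) by ring.
    apply Rmult_lt_compat_r; [lra|]. nra. }
  nra.
Qed.

(** * Schwarz lemma *)

Lemma CPSeries_ext (a b : nat -> C) (z : C) : (forall k, a k = b k) -> CPSeries a z = CPSeries b z.
Proof.
  intros E. unfold CPSeries, CSeries. f_equal; apply Series_ext; intros k; rewrite E; reflexivity.
Qed.

Lemma CPSeries_vanishing (n : nat) (b : nat -> C) (z : C) :
  disc_coefs b -> Cmod z < 1 -> (forall k, (k < n)%nat -> b k = RtoC 0) ->
  disc_coefs (fun j => b (j + n)%nat) /\ CPSeries b z = (z ^ n * CPSeries (fun j => b (j + n)%nat) z)%C.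
Proof.
  revert b; induction n as [|n IH]; intros b Hb Hz H0.
  - rewrite (CPSeries_ext (fun j => b (j + 0)%nat) b) by (intros; f_equal; lia). split.
    + intros r Hr. destruct (Hb r Hr) as [M HM]. exists M; intros k.
      rewrite Nat.add_0_r. apply HM.
    + simpl; ring.
  - destruct (IH (fun k => b (S k)) (disc_coefs_shift b Hb) Hz) as [H1 H2].
    { intros k Hk; apply H0; lia. }
    split.
    + intros r Hr. destruct (H1 r Hr) as [M HM]. exists M; intros k.
      replace (k + S n)%nat with (S (k + n)) by lia. apply HM.
    + rewrite CPSeries_prepend, H0, H2 by (auto; lia).
      rewrite (CPSeries_ext (fun j => b (j + S n)%nat) (fun j => b (S (j + n)))) by (intros; f_equal; lia).
      simpl; ring.
Qed.

Lemma class_A_coefficients (n : nat) (f : C -> C) :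
  class_A n f -> exists a : nat -> C, a 0%nat = RtoC 0 /\ a 1%nat = RtoC 1 /\
    (forall k, (2 <= k <= n)%nat -> a k = RtoC 0) /\ disc_coefs a /\
    forall z, Cmod z < 1 -> f z = CPSeries a z.
Proof.
  intros [a [H0 [H1 [H2 H3]]]]. exists a.
  assert (H : forall z : C, Cmod z < 1 -> is_CSeries (fun k => a k * z ^ k)%C (f z)).
  { intros z Hz. rewrite <- Cnorm_Cmod in Hz. specialize (H3 z Hz).
    apply Cseries_to_CS in H3. eapply is_CSeries_ext; [|exact H3].
    intros k; cbv beta. rewrite Cpow_Cpow; reflexivity. }
  split; [exact H0|]. split; [exact H1|]. split; [exact H2|]. split.
  - apply disc_coefs_of_convergent. intros z Hz. exists (f z); auto.
  - intros z Hz. symmetry; apply CPSeries_unique; auto.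
Qed.

Lemma CPSeries_cderiv (f : C -> C) (a : nat -> C) (z : C) :
  disc_coefs a -> (forall z, Cmod z < 1 -> f z = CPSeries a z) -> Cmod z < 1 ->
  cderiv f z (CPSeries (deriv_coef a) z).
Proof.
  intros Ha Hf Hz. destruct (CPSeries_jet2 a z Ha Hz) as [B HB].
  apply (jet2_cderiv (CPSeries a) f z _ B (1 - Cmod z)); [lra| |exact HB].
  intros h Hh. apply Hf. eapply Rle_lt_trans; [apply Cmod_triangle|]. lra.
Qed.

Lemma Qf_val_nonzero (f : C -> C) (a : nat -> C) (z w : C) :
  disc_coefs a -> (forall z, Cmod z < 1 -> f z = CPSeries a z) -> Cmod z < 1 -> z <> RtoC 0 ->
  Qf_val f z w <-> f z <> RtoC 0 /\ w = (z * CPSeries (deriv_coef a) z / f z)%C.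
Proof.
  intros Ha Hf Hz Hnz. pose proof (CPSeries_cderiv f a z Ha Hf Hz) as Hd. split.
  - intros [[E _]|[_ [Hfz [l [Hl ->]]]]]; [contradiction|]. split; [exact Hfz|].
    rewrite Cdiv_Cdiv, (cderiv_unique f z l _ Hl Hd). reflexivity.
  - intros [Hfz ->]. right. split; [exact Hnz|]. split; [exact Hfz|].
    exists (CPSeries (deriv_coef a) z). split; [exact Hd|]. rewrite Cdiv_Cdiv; reflexivity.
Qed.

(** [|c - X|^2 - |X|^2 = c (c - 2 Re X)]: the half-plane consists of the points nearer to 0 than to
    [c]. *)
Lemma Cmod_lt_reflection (c : R) (X : C) :
  0 < c -> 2 * fst X < c -> Cmod X < Cmod (RtoC c - X)%C.
Proof.
  intros Hc HX. pose proof (Cmod_sqr X). pose proof (Cmod_sqr (RtoC c - X)%C) as H1.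
  cbn in H1. pose proof (Cmod_ge_0 X). pose proof (Cmod_ge_0 (RtoC c - X)%C). nra.
Qed.

(** The relation between [w] and [omega] is kept free of division, in the shape that the triangle
    inequality uses next. *)
Lemma class_M_schwarz (n : nat) (beta : R) (f : C -> C) (rho : R) (z w : C) :
  (1 <= n)%nat -> 1 < beta -> class_M n beta f -> rho <= 1 -> z <> RtoC 0 -> Cmod z < rho ->
  Qf_val f z w ->
  exists omega : C, Cmod omega < rho ^ n /\
    ((w - 1) * (1 + omega) = RtoC (2 * (beta - 1)) * omega)%C.
Proof.
  intros Hn Hb [HA HM] Hrho Hnz Hz Hw.
  destruct (class_A_coefficients n f HA) as [a [Ha0 [Ha1 [Ha2 [Ha Hf]]]]].
  set (c := 2 * (beta - 1)). assert (Hc : 0 < c) by (unfold c; lra).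
  (* [g] is the series of [f / z] and [b] that of [z g'], so [X = b / g]. The shift by one makes [b]
     vanish below index [n]. *)
  set (g := fun k => a (S k)).
  assert (Hg : disc_coefs g) by exact (disc_coefs_shift a Ha).
  set (b := fun k => (RtoC (INR k) * g k)%C).
  assert (Hb' : disc_coefs b) by exact (disc_coefs_INR g Hg).
  assert (Hb0 : forall k, (k < n)%nat -> b k = RtoC 0).
  { intros [|k] Hk; unfold b, g; [simpl; ring|]. rewrite Ha2 by lia. ring. }
  set (K := CPSeries (fun j => b (j + n)%nat)).
  assert (HKadm : disc_coefs (fun j => b (j + n)%nat)).
  { apply (CPSeries_vanishing n b 0 Hb'); [rewrite Cmod_0; lra|exact Hb0]. }
  assert (HbK : forall u, Cmod u < 1 -> CPSeries b u = (u ^ n * K u)%C).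
  { intros u Hu. apply CPSeries_vanishing; auto. }
  assert (HPSa : forall u, Cmod u < 1 -> CPSeries a u = (u * CPSeries g u)%C).
  { intros u Hu. rewrite CPSeries_prepend, Ha0 by auto. fold g. ring. }
  assert (HPSd : forall u, Cmod u < 1 -> CPSeries (deriv_coef a) u = (CPSeries g u + u ^ n * K u)%C).
  { intros u Hu. rewrite <- HbK by exact Hu.
    assert (E : CPSeries b u = (CPSeries (deriv_coef a) u - CPSeries g u)%C).
    { rewrite <- (CPSeries_minus _ _ u (disc_coefs_deriv a Ha) Hg Hu). apply CPSeries_ext; intros k.
      unfold b, deriv_coef. fold (g k). rewrite S_INR, RtoC_plus. ring. }
    rewrite E; ring. }
  (* The denominator [c g - b] of [omega = X / (c - X)]. *)
  set (dc := fun k => (RtoC c * g k - b k)%C).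
  assert (Hdc : disc_coefs dc) by exact (disc_coefs_minus _ _ (disc_coefs_scal (RtoC c) g Hg) Hb').
  assert (HD : forall u, Cmod u < 1 -> CPSeries dc u = (RtoC c * CPSeries g u - u ^ n * K u)%C).
  { intros u Hu. unfold dc. rewrite (CPSeries_minus _ _ u (disc_coefs_scal (RtoC c) g Hg) Hb' Hu).
    rewrite CPSeries_scal, HbK by auto. reflexivity. }
  assert (HX : forall u, Cmod u < 1 -> u <> RtoC 0 -> forall q, Qf_val f u q ->
     CPSeries g u <> RtoC 0 /\ q = (1 + u ^ n * K u / CPSeries g u)%C).
  { intros u Hu Hu0 q Hq. apply (Qf_val_nonzero f a u q Ha Hf Hu Hu0) in Hq.
    destruct Hq as [Hfu ->]. rewrite Hf, HPSa in * by auto.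
    assert (CPSeries g u <> RtoC 0) by (intros E; apply Hfu; rewrite E; apply Cmult_0_r).
    split; [assumption|]. rewrite HPSd by auto. match goal with |- ?x = ?y => change (@eq C x y) end. field. auto. }
  assert (HXM : forall u, Cmod u < 1 -> u <> RtoC 0 ->
     CPSeries g u <> RtoC 0 /\ CPSeries dc u <> RtoC 0 /\ Cmod (u ^ n * (K u / CPSeries dc u))%C <= 1).
  { intros u Hu Hu0.
    assert (Hu' : Cnorm u < 1) by (rewrite Cnorm_Cmod; exact Hu).
    destruct (HM u Hu') as [q [Hq Hqb]].
    destruct (HX u Hu Hu0 q Hq) as [Hgu Eq].
    set (X := (u ^ n * K u / CPSeries g u)%C) in *.
    assert (HXr : 2 * fst X < c).
    { rewrite Eq in Hqb. change (1 + fst X < beta) in Hqb. unfold c; lra. }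
    pose proof (Cmod_lt_reflection c X Hc HXr) as Hlt.
    pose proof (Cmod_ge_0 X).
    assert (Hcx : (RtoC c - X)%C <> RtoC 0) by (apply Cmod_gt_0; lra).
    assert (E : CPSeries dc u = (CPSeries g u * (RtoC c - X))%C).
    { rewrite HD by exact Hu. unfold X. field. exact Hgu. }
    assert (Hdu : CPSeries dc u <> RtoC 0) by (rewrite E; apply Cmult_neq_0; assumption).
    split; [exact Hgu|]. split; [exact Hdu|].
    replace (u ^ n * (K u / CPSeries dc u))%C with (X / (RtoC c - X))%C.
    2:{ rewrite E. unfold X. field. split; [exact Hgu|].
        intros E0; apply Hcx. unfold X.
        transitivity ((RtoC c * CPSeries g u - u ^ n * K u) / CPSeries g u)%C; [field; exact Hgu|].
        rewrite E0. field. exact Hgu. }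
    rewrite Cmod_div by exact Hcx. apply (proj2 (Rle_div_l _ _ (Cmod (RtoC c - X)) ltac:(lra))). lra. }
  assert (Hd0 : forall u, Cmod u < 1 -> CPSeries dc u <> RtoC 0).
  { intros u Hu. destruct (Ceq_dec u 0) as [->|Hu0]; [|apply HXM; assumption].
    rewrite CPSeries_0 by exact Hdc. unfold dc, b, g. rewrite Ha1. change (INR 0) with 0.
    intros E. apply (f_equal fst) in E. cbn in E. lra. }
  assert (Hz0 : 0 < Cmod z) by (apply Cmod_gt_0; exact Hnz).
  assert (Hr0 : Cmod z / rho < 1) by (apply (proj2 (Rlt_div_l _ _ rho ltac:(lra))); lra).
  assert (Hzr : Cmod z <= Cmod z / rho).
  { apply (proj1 (Rle_div_r _ _ rho ltac:(lra))). nra. }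
  (* A single circle suffices instead of a limit [r -> 1]: since [|z| < rho r], the bound
     [(|z| / r)^n] is already below [rho^n]. *)
  set (r := (Cmod z / rho + 1) / 2).
  assert (Hr : Cmod z / rho < r < 1) by (unfold r; lra).
  assert (Hrn : 0 < r ^ n) by (apply pow_lt; lra).
  assert (HG : Cmod (K z / CPSeries dc z)%C <= / r ^ n).
  { apply (maximum_principle (fun u => K u / CPSeries dc u)%C r); [lra| | |lra].
    - intros u Hu. destruct (CPSeries_jet2 _ u HKadm ltac:(lra)) as [B1 J1].
      destruct (CPSeries_jet2 _ u Hdc ltac:(lra)) as [B2 J2].
      apply (jet2_div K (CPSeries dc) u _ _ _ _ J1 J2). apply Hd0; lra.
    - intros u Hu. assert (Hu0 : u <> RtoC 0) by (apply Cmod_gt_0; lra).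
      destruct (HXM u ltac:(lra) Hu0) as [_ [_ H]].
      rewrite Cmod_mult, Cmod_pow, Hu in H.
      apply (Rmult_le_reg_l (r ^ n)); [exact Hrn|]. rewrite Rinv_r; lra. }
  assert (Hz1 : Cmod z < 1) by lra.
  destruct (HX z Hz1 Hnz w Hw) as [Hgz Ew].
  exists (z ^ n * (K z / CPSeries dc z))%C. split.
  - rewrite Cmod_mult, Cmod_pow.
    apply Rle_lt_trans with (Cmod z ^ n * / r ^ n).
    + apply Rmult_le_compat_l; [apply pow_le; lra|exact HG].
    + apply (proj2 (Rlt_div_l _ _ (r ^ n) ltac:(lra))). rewrite <- Rpow_mult_distr.
      assert (Hlt : Cmod z < rho * r).
      { destruct Hr as [Hr _]. apply (proj1 (Rlt_div_l _ _ rho ltac:(lra))) in Hr. lra. }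
      clear - Hn Hlt Hz0. destruct n as [|n]; [lia|]. clear Hn.
      induction n as [|n IH]; [simpl; lra|].
      change (Cmod z * Cmod z ^ S n < (rho * r) * (rho * r) ^ S n).
      apply Rmult_le_0_lt_compat; try lra. apply pow_le; lra.
  - rewrite Ew. pose proof (Hd0 z Hz1) as Hdz. rewrite HD in * by exact Hz1.
    fold c. field. split; assumption.
Qed.

(** * The disc of radius 2/3 about 1 *)

(** [|X| (1 - |omega|) <= c |omega|] with [c = 2 (beta - 1)], and [c t / (1 - t) = 2/3] precisely at
    [t = 1 / (3 beta - 2)]. *)
Lemma log_derivative_bound (beta : R) (X omega : C) :
  1 < beta -> Cmod omega < / (3 * beta - 2) ->
  (X * (1 + omega) = RtoC (2 * (beta - 1)) * omega)%C -> Cmod X < 2 / 3.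
Proof.
  intros Hb Ho E.
  assert (E' : X = (RtoC (2 * (beta - 1)) * omega - X * omega)%C) by (rewrite <- E; ring).
  assert (H : Cmod X <= 2 * (beta - 1) * Cmod omega + Cmod X * Cmod omega).
  { rewrite E' at 1. unfold Cminus. eapply Rle_trans; [apply Cmod_triangle|].
    rewrite Cmod_opp, !Cmod_mult, Cmod_R, Rabs_pos_eq; lra. }
  pose proof (Cmod_ge_0 omega). pose proof (Cmod_ge_0 X).
  assert (Ho' : Cmod omega * (3 * beta - 2) < 1).
  { apply (Rmult_lt_compat_r (3 * beta - 2)) in Ho; [|lra]. rewrite Rinv_l in Ho; lra. }
  assert (Cmod omega < 1) by nra.
  apply Rnot_le_lt; intros Hx. nra.
Qed.

(** Banach iteration: [T] has derivative [u^2], hence contracts by [r^2] on the closed disc of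
    radius [r < 1]. Completeness enters through the series of increments. *)
Lemma cubic_root_exists (v : C) :
  Cmod v < 2 / 3 -> exists u : C, Cmod u < 1 /\ (u = v + RtoC (1 / 3) * u ^ 3)%C.
Proof.
  intros Hv. pose proof (Cmod_ge_0 v) as Hv0.
  (* With [|v| = 2/3 - d] and [r = 1 - d], invariance of the disc reduces to [r^3 <= 1]. *)
  set (d := 2 / 3 - Cmod v). set (r := 1 - d).
  assert (Hd : 0 < d <= 2 / 3) by (unfold d; lra).
  assert (Hr : Cmod v + r ^ 3 / 3 <= r).
  { unfold r. replace (Cmod v) with (2 / 3 - d) by (unfold d; ring). nra. }
  assert (Hr1 : 1 / 3 <= r < 1) by (unfold r; lra).
  set (T := fun u : C => (v + RtoC (1 / 3) * u ^ 3)%C).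
  set (x := fun k => Nat.iter k T (RtoC 0)).
  assert (Hx : forall k, Cmod (x k) <= r).
  { induction k as [|k IH]; [simpl; rewrite Cmod_0; lra|].
    change (x (S k)) with (T (x k)). unfold T. eapply Rle_trans; [apply Cmod_triangle|].
    rewrite Cmod_mult, Cmod_R, Cmod_pow, Rabs_pos_eq by lra.
    pose proof (pow_incr _ _ 3 (conj (Cmod_ge_0 (x k)) IH)). lra. }
  assert (HT : forall u w, Cmod u <= r -> Cmod w <= r -> Cmod (T u - T w)%C <= r ^ 2 * Cmod (u - w)%C).
  { intros u w Hu Hw. unfold T.
    replace (v + RtoC (1 / 3) * u ^ 3 - (v + RtoC (1 / 3) * w ^ 3))%C
      with ((RtoC (1 / 3) * (u * u + u * w + w * w)) * (u - w))%C by ring.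
    rewrite Cmod_mult. apply Rmult_le_compat_r; [apply Cmod_ge_0|].
    rewrite Cmod_mult, Cmod_R, Rabs_pos_eq by lra.
    pose proof (Cmod_triangle (u * u + u * w) (w * w)).
    pose proof (Cmod_triangle (u * u) (u * w)).
    rewrite !Cmod_mult in *. pose proof (Cmod_ge_0 u). pose proof (Cmod_ge_0 w).
    set (p := Cmod u) in *. set (q := Cmod w) in *.
    assert (p * p <= r * r) by nra. assert (p * q <= r * r) by nra. assert (q * q <= r * r) by nra.
    simpl. lra. }
  set (D := fun k => (x (S k) - x k)%C).
  assert (HDb : forall k, Cmod (D k) <= 1 * (r ^ 2) ^ k).
  { induction k as [|k IH].
    - assert (E0 : D 0%nat = x 1%nat) by (unfold D; change (x 0%nat) with (RtoC 0); ring).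
      rewrite E0, pow_O. specialize (Hx 1%nat). lra.
    - unfold D. change (x (S (S k))) with (T (x (S k))). change (x (S k)) with (T (x k)) at 2.
      eapply Rle_trans; [apply HT; apply Hx|]. fold (D k).
      replace (1 * (r ^ 2) ^ S k) with (r ^ 2 * (1 * (r ^ 2) ^ k)) by (simpl; ring).
      apply Rmult_le_compat_l; [apply pow_le; lra|exact IH]. }
  assert (Hr2 : 0 <= r ^ 2 < 1) by (simpl; nra).
  destruct (is_CSeries_ex D (fun k => 1 * (r ^ 2) ^ k) HDb) as [U HU].
  { apply (ex_series_scal (V := R_NormedModule) 1). apply ex_series_geom.
    rewrite Rabs_pos_eq; lra. }
  (* The increments telescope from [x 0 = 0], so the iterates are the partial sums. *)
  assert (Hsum : forall m, sum_n D m = x (S m)).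
  { induction m as [|m IH].
    - rewrite sum_O. change (x 1%nat - RtoC 0 = x 1%nat)%C. ring.
    - rewrite sum_Sn, IH. change (x (S m) + D (S m) = x (S (S m)))%C. unfold D. ring. }
  assert (Hlim : forall eps, eps > 0 -> exists m, Cmod (x (S m) - U)%C < eps /\ Cmod (x (S (S m)) - U)%C < eps).
  { intros eps He. destruct (proj1 (is_CSeries_eps D U) HU eps He) as [N HN].
    exists N. split; [specialize (HN N (le_n N))|specialize (HN (S N) (le_S _ _ (le_n N)))];
    rewrite Hsum in HN; exact HN. }
  assert (HUr : Cmod U <= r).
  { apply le_epsilon; intros eps He. destruct (Hlim eps He) as [m [Hm _]].
    specialize (Hx (S m)). rewrite Cmod_minus_sym in Hm.
    replace U with ((U - x (S m)) + x (S m))%C by ring.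
    eapply Rle_trans; [apply Cmod_triangle|]. lra. }
  exists U. split; [lra|]. fold (T U).
  apply Ceq_minus. apply Cmod_eq_0. apply Rle_antisym; [|apply Cmod_ge_0].
  apply le_epsilon; intros eps He. destruct (Hlim (eps / 2) ltac:(lra)) as [m [Hm1 Hm2]].
  replace (U - T U)%C with (- (x (S (S m)) - U) + (T (x (S m)) - T U))%C
    by (change (x (S (S m))) with (T (x (S m))); ring).
  eapply Rle_trans; [apply Cmod_triangle|]. rewrite Cmod_opp.
  pose proof (HT (x (S m)) U (Hx (S m)) HUr). pose proof (Cmod_ge_0 (x (S m) - U)). nra.
Qed.

Lemma disc_in_Omega_Ne (w : C) : Cmod (w - 1)%C < 2 / 3 -> in_Omega_Ne w.
Proof.
  intros H. destruct (cubic_root_exists _ H) as [u [Hu E]].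
  exists u. split; [rewrite Cnorm_Cmod; exact Hu|].
  unfold phi_Ne. rewrite Cpow_Cpow.
  change (w = 1 + (u - RtoC (1 / 3) * u ^ 3))%C.
  replace (u - RtoC (1 / 3) * u ^ 3)%C with (w - 1)%C; [ring|].
  rewrite E at 1. ring.
Qed.

(** * The extremal function *)

(* The Taylor coefficients of [(1 - u)^s]. *)
Fixpoint binom_coef (s : R) (k : nat) : R :=
  match k with O => 1 | S k' => binom_coef s k' * ((INR k' - s) / INR (S k')) end.

Lemma disc_coefs_binom (s : R) : 0 < s -> disc_coefs (fun k => RtoC (binom_coef s k)).
Proof.
  intros Hs. apply disc_coefs_mono; intros r Hr.
  (* The ratio of consecutive terms is at most [(k + s) r / (k + 1)], which is at most 1 once
     [k >= s r / (1 - r)]. *)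
  destruct (nfloor_ex (s * r / (1 - r))) as [N HN]; [apply Rdiv_le_0_compat; nra|].
  apply (bounded_of_eventually_decreasing (fun k => Cmod (RtoC (binom_coef s k)) * r ^ k) (S N)).
  - intros k. apply Rmult_le_pos; [apply Cmod_ge_0|apply pow_le; lra].
  - intros k Hk. apply le_INR in Hk. rewrite S_INR in Hk.
    rewrite !Cmod_R. change (r ^ S k) with (r * r ^ k).
    change (binom_coef s (S k)) with (binom_coef s k * ((INR k - s) / INR (S k))).
    rewrite Rabs_mult, S_INR. pose proof (pos_INR k).
    rewrite <- Rmult_assoc. apply Rmult_le_compat_r; [apply pow_le; lra|].
    rewrite Rmult_assoc. rewrite <- (Rmult_1_r (Rabs (binom_coef s k))) at 2.
    apply Rmult_le_compat_l; [apply Rabs_pos|].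
    rewrite Rabs_div by lra. rewrite (Rabs_pos_eq (INR k + 1)) by lra.
    assert (Rabs (INR k - s) <= INR k + s) by (apply Rabs_le; lra).
    assert (Hk' : s * r / (1 - r) <= INR k) by lra.
    apply (proj1 (Rle_div_l _ _ (1 - r) ltac:(lra))) in Hk'.
    apply Rle_trans with ((INR k + s) / (INR k + 1) * r).
    + apply Rmult_le_compat_r; [lra|]. apply Rmult_le_compat_r; [|lra].
      left; apply Rinv_0_lt_compat; lra.
    + apply (Rmult_le_reg_r (INR k + 1)); [lra|].
      replace ((INR k + s) / (INR k + 1) * r * (INR k + 1)) with ((INR k + s) * r) by (field; lra).
      lra.
Qed.

Definition binom_series (s : R) : C -> C := CPSeries (fun k => RtoC (binom_coef s k)).

Definition binom_series_deriv (s : R) : C -> C := CPSeries (deriv_coef (fun k => RtoC (binom_coef s k))).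

(** Coefficientwise this is the recurrence [(k + 1) b_(k+1) = (k - s) b_k]. *)
Lemma binom_series_ode (s : R) (u : C) :
  0 < s -> Cmod u < 1 ->
  ((1 - u) * binom_series_deriv s u = - RtoC s * binom_series s u)%C.
Proof.
  intros Hs Hu. pose proof (disc_coefs_binom s Hs) as Ha. unfold binom_series, binom_series_deriv.
  set (a := fun k => RtoC (binom_coef s k)) in *.
  transitivity (CPSeries (deriv_coef a) u - u * CPSeries (deriv_coef a) u)%C; [ring|].
  rewrite CPSeries_euler by assumption.
  rewrite <- (CPSeries_minus _ _ u (disc_coefs_deriv a Ha) (disc_coefs_INR a Ha) Hu).
  rewrite <- CPSeries_scal by assumption.
  apply CPSeries_ext; intros k. unfold deriv_coef, a.
  change (binom_coef s (S k)) with (binom_coef s k * ((INR k - s) / INR (S k))).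
  rewrite <- !RtoC_mult, <- RtoC_minus, <- RtoC_opp, <- RtoC_mult. f_equal.
  field. apply not_0_INR; lia.
Qed.

Lemma line_derive (F : C -> C) (u : C) (t : R) (A : C) :
  cderiv F (RtoC t * u)%C A ->
  is_derive (fun t => fst (F (RtoC t * u)%C)) t (fst (u * A)%C) /\
  is_derive (fun t => snd (F (RtoC t * u)%C)) t (snd (u * A)%C).
Proof.
  intros H.
  assert (Hmain : forall eps, 0 < eps -> exists d : posreal, forall h, h <> 0 -> Rabs h < d ->
     Cmod ((F (RtoC (t + h) * u) - F (RtoC t * u)) / RtoC h - u * A)%C < eps).
  { intros eps He. destruct (Ceq_dec u 0) as [->|Hu].
    - exists (mkposreal 1 Rlt_0_1). intros h Hh _.
      rewrite !Cmult_0_r.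
      replace ((F (RtoC 0) - F (RtoC 0)) / RtoC h - 0 * A)%C with (RtoC 0).
      + rewrite Cmod_0; lra.
      + field. intros E; apply Hh, RtoC_inj, E.
    - pose proof (proj1 (Cmod_gt_0 u) Hu) as Hu0.
      destruct (H (eps / Cmod u)) as [d [Hd H']]; [apply Rdiv_lt_0_compat; lra|].
      assert (Hd' : 0 < d / Cmod u) by (apply Rdiv_lt_0_compat; lra).
      exists (mkposreal _ Hd'). intros h Hh Hhd. simpl in Hhd.
      apply (proj2 (Rlt_div_r _ _ (Cmod u) ltac:(lra))) in Hhd.
      assert (Hhn : RtoC h <> RtoC 0) by (intros E; apply Hh, RtoC_inj, E).
      specialize (H' (RtoC h * u)%C). rewrite !Cnorm_Cmod, Cdiv_Cdiv, Cmod_mult, Cmod_R in H'.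
      specialize (H' (conj (Rmult_lt_0_compat _ _ (Rabs_pos_lt h Hh) Hu0) Hhd)).
      change (Cmod ((F (RtoC t * u + RtoC h * u) - F (RtoC t * u)) / (RtoC h * u) - A)%C
                < eps / Cmod u) in H'.
      apply (proj2 (Rlt_div_r _ _ (Cmod u) ltac:(lra))) in H'.
      rewrite <- Cmod_mult in H'.
      replace (RtoC (t + h) * u)%C with (RtoC t * u + RtoC h * u)%C by (rewrite RtoC_plus; ring).
      eapply Rle_lt_trans; [|exact H']. right; f_equal. field. split; assumption. }
  assert (Hdiv : forall (w : C) h, h <> 0 -> (w / RtoC h)%C = (fst w / h, snd w / h)).
  { intros w h Hh. unfold Cdiv, Cinv, Cmult, RtoC; simpl. f_equal; field; exact Hh. }
  split; apply is_derive_Reals; intros eps He; destruct (Hmain eps He) as [d Hd]; exists d;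
    intros h Hh Hhd; specialize (Hd h Hh Hhd); rewrite Hdiv in Hd by exact Hh;
    (eapply Rle_lt_trans; [|exact Hd]); (eapply Rle_trans; [|apply Rmax_Cmod]).
  - apply Rmax_l.
  - apply Rmax_r.
Qed.

(* [Z1 + i Z2 = (X + i Y) exp (- s (L + i th))] is constant when [X + i Y] solves
   [(X + i Y)' = s (L + i th)' (X + i Y)]. *)
Lemma integrating_factor (s : R) (X Y L th : R -> R) (t p q : R) :
  is_derive X t (s * (p * X t - q * Y t)) -> is_derive Y t (s * (q * X t + p * Y t)) ->
  is_derive L t p -> is_derive th t q ->
  is_derive (fun t => exp (- s * L t) * (X t * cos (s * th t) + Y t * sin (s * th t))) t 0 /\
  is_derive (fun t => exp (- s * L t) * (Y t * cos (s * th t) - X t * sin (s * th t))) t 0.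
Proof.
  intros HX HY HL Hth.
  assert (EX : Derive (fun x : R => X x) t = _) by exact (is_derive_unique _ _ _ HX).
  assert (EY : Derive (fun x : R => Y x) t = _) by exact (is_derive_unique _ _ _ HY).
  assert (EL : Derive (fun x : R => L x) t = _) by exact (is_derive_unique _ _ _ HL).
  assert (Eth : Derive (fun x : R => th x) t = _) by exact (is_derive_unique _ _ _ Hth).
  split; auto_derive; try (repeat split; trivial; eexists; eassumption);
    rewrite EX, EY, EL, Eth; ring.
Qed.

(** Both sides solve the same linear equation along the ray from 0 to [u]. There [Re (1 - t u) > 0],
    which is where [atan] gives the argument. *)
Lemma binom_series_cpow (s : R) (u : C) :
  0 < s -> Cmod u < 1 -> binom_series s u = cpow_pos (1 - u)%C s.
Proof.
  intros Hs Hu. destruct u as [x y].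
  pose proof (Rmax_Cmod (x, y)) as Hm. cbn [fst snd] in Hm.
  pose proof (Rmax_l (Rabs x) (Rabs y)). pose proof (Rle_abs x).
  assert (Hx : x < 1) by lra.
  set (S := binom_series s).
  set (X := fun t => fst (S (RtoC t * (x, y))%C)).
  set (Y := fun t => snd (S (RtoC t * (x, y))%C)).
  (* [L + i th] is the logarithm of [1 - t u]; its derivative [- u / (1 - t u)] is [p + i q]
     below. *)
  set (L := fun t => ln ((1 - t * x) ^ 2 + (t * y) ^ 2) / 2).
  set (th := fun t => atan (- (t * y) / (1 - t * x))).
  assert (Hder : forall t, 0 <= t <= 1 ->
    is_derive (fun t => exp (- s * L t) * (X t * cos (s * th t) + Y t * sin (s * th t))) t 0 /\
    is_derive (fun t => exp (- s * L t) * (Y t * cos (s * th t) - X t * sin (s * th t))) t 0).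
  { intros t Ht.
    assert (Htx : 0 < 1 - t * x) by (destruct (Rle_dec x 0); nra).
    assert (Hq : 0 < (1 - t * x) ^ 2 + (t * y) ^ 2).
    { pose proof (pow_lt _ 2 Htx). pose proof (pow2_ge_0 (t * y)). lra. }
    set (qq := (1 - t * x) ^ 2 + (t * y) ^ 2) in *.
    set (z := (RtoC t * (x, y))%C).
    assert (Hz : Cmod z < 1).
    { unfold z. rewrite Cmod_mult, Cmod_R, Rabs_pos_eq by lra. pose proof (Cmod_ge_0 (x, y)). nra. }
    pose proof (CPSeries_cderiv S _ z (disc_coefs_binom s Hs) (fun _ _ => eq_refl) Hz) as Hc.
    destruct (line_derive S (x, y) t _ Hc) as [D1 D2].
    fold (binom_series_deriv s z) in D1, D2.
    pose proof (binom_series_ode s z Hs Hz) as Hode. fold S in Hode.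
    set (p := (- (1 - t * x) * x + t * y * y) / qq). set (q := - y / qq).
    assert (E : ((x, y) * binom_series_deriv s z)%C = (RtoC s * (p, q) * S z)%C).
    { assert (Hnz : (1 - z)%C <> RtoC 0).
      { intros E. apply (f_equal fst) in E. unfold z in E. cbn in E. lra. }
      transitivity ((x, y) * ((1 - z) * binom_series_deriv s z) / (1 - z))%C; [field; exact Hnz|].
      rewrite Hode.
      transitivity (RtoC s * (- (x, y) / (1 - z)) * S z)%C; [field; exact Hnz|].
      do 2 f_equal. unfold p, q, z, qq, Cdiv, Cinv, Cmult, Copp, Cminus, Cplus, RtoC. cbn.
      unfold qq in Hq; cbn in Hq.
      f_equal; field; apply Rgt_not_eq; lra. }
    rewrite E in D1, D2.
    apply (integrating_factor s X Y L th t p q).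
    - replace (s * (p * X t - q * Y t)) with (fst (RtoC s * (p, q) * S z)%C).
      + exact D1.
      + unfold X, Y. fold z. cbn. ring.
    - replace (s * (q * X t + p * Y t)) with (snd (RtoC s * (p, q) * S z)%C).
      + exact D2.
      + unfold X, Y. fold z. cbn. ring.
    - unfold L. auto_derive; [exact Hq|]. unfold p, qq in *. field. lra.
    - unfold th. auto_derive; [lra|]. unfold q, qq in *. field.
      split; apply Rgt_not_eq; [|lra]. simpl in *. nra. }
  pose proof (eq_is_derive _ 0 1 (fun t Ht => proj1 (Hder t Ht)) Rlt_0_1) as E1.
  pose proof (eq_is_derive _ 0 1 (fun t Ht => proj2 (Hder t Ht)) Rlt_0_1) as E2.
  cbv beta in E1, E2.
  assert (HS0 : S (RtoC 0 * (x, y))%C = RtoC 1).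
  { rewrite Cmult_0_l. unfold S, binom_series. rewrite CPSeries_0 by (apply disc_coefs_binom; exact Hs). reflexivity. }
  assert (X0 : X 0 = 1) by (unfold X; rewrite HS0; reflexivity).
  assert (Y0 : Y 0 = 0) by (unfold Y; rewrite HS0; reflexivity).
  assert (L0 : L 0 = 0).
  { unfold L. replace ((1 - 0 * x) ^ 2 + (0 * y) ^ 2) with 1 by ring. rewrite ln_1. lra. }
  assert (T0 : th 0 = 0).
  { unfold th. replace (- (0 * y) / (1 - 0 * x)) with 0 by field. apply atan_0. }
  rewrite X0, Y0, L0, T0 in E1, E2. rewrite !Rmult_0_r, cos_0, sin_0, exp_0 in E1, E2.
  assert (HS1 : S (x, y) = (X 1, Y 1)).
  { unfold X, Y. rewrite Cmult_1_l. apply surjective_pairing. }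
  change (binom_series s (x, y)) with (S (x, y)). rewrite HS1.
  unfold cpow_pos.
  assert (Hth : atan (Defs.Im (1 - (x, y))%C / Defs.Re (1 - (x, y))%C) = th 1).
  { unfold th, Defs.Im, Defs.Re. cbn. f_equal. f_equal; ring. }
  rewrite Hth, Cnorm_Cmod.
  assert (HL : Rpower (Cmod (1 - (x, y))%C) s = exp (s * L 1)).
  { unfold Rpower. f_equal. f_equal. unfold L.
    assert (Hw : 0 < Cmod (1 - (x, y))%C).
    { apply Cmod_gt_0. intros E. apply (f_equal fst) in E. cbn in E. lra. }
    replace ((1 - 1 * x) ^ 2 + (1 * y) ^ 2) with (Cmod (1 - (x, y))%C * Cmod (1 - (x, y))%C).
    - rewrite ln_mult by assumption. field.
    - pose proof (Cmod_sqr (1 - (x, y))%C) as E. cbn in E. cbn. lra. }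
  rewrite HL.
  set (eL := exp (- s * L 1)) in *.
  assert (Hexp : exp (s * L 1) * eL = 1).
  { unfold eL. rewrite <- exp_plus. replace (s * L 1 + - s * L 1) with 0 by ring. apply exp_0. }
  set (ep := exp (s * L 1)) in *.
  pose proof (sin2_cos2 (s * th 1)) as Hsc. unfold Rsqr in Hsc.
  set (co := cos (s * th 1)) in *. set (si := sin (s * th 1)) in *.
  (* The conserved quantity equals [1 + 0 i] at [t = 0]; multiplying by [exp (s L)] and undoing the
     rotation yields [X 1] and [Y 1]. *)
  assert (F1 : X 1 * co + Y 1 * si = ep).
  { transitivity (ep * eL * (X 1 * co + Y 1 * si)); [rewrite Hexp; ring|].
    rewrite Rmult_assoc, <- E1. ring. }
  assert (F2 : Y 1 * co - X 1 * si = 0).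
  { transitivity (ep * eL * (Y 1 * co - X 1 * si)); [rewrite Hexp; ring|].
    rewrite Rmult_assoc, <- E2. ring. }
  f_equal.
  - assert (E : X 1 * (si * si + co * co)
      = co * (X 1 * co + Y 1 * si) - si * (Y 1 * co - X 1 * si)) by ring.
    rewrite Hsc, F1, F2 in E. lra.
  - assert (E : Y 1 * (si * si + co * co)
      = si * (X 1 * co + Y 1 * si) + co * (Y 1 * co - X 1 * si)) by ring.
    rewrite Hsc, F1, F2 in E. lra.
Qed.

(* [b j] placed at the index [1 + n j]. *)
Definition sparse (n : nat) (b : nat -> C) (k : nat) : C :=
  match k with
  | O => RtoC 0
  | S k' => if Nat.eqb (k' mod n) 0 then b (k' / n)%nat else RtoC 0
  end.

Lemma is_CSeries_sparse (n : nat) (b : nat -> C) (s : C) :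
  (1 <= n)%nat -> is_CSeries b s -> is_CSeries (sparse n b) s.
Proof.
  intros Hn H.
  (* Partial sums of the spread series repeat those of [b]; the successor accounts for the zero at
     index 0. *)
  assert (Hsum : forall m, sum_n (sparse n b) (S m) = sum_n b (m / n)).
  { induction m as [|m IH].
    - rewrite sum_Sn, sum_O, Nat.Div0.div_0_l, sum_O. unfold sparse.
      rewrite Nat.Div0.mod_0_l, Nat.Div0.div_0_l. exact (Cplus_0_l _).
    - rewrite sum_Sn, IH. unfold sparse.
      pose proof (Nat.div_mod_eq m n) as Hdm. pose proof (Nat.mod_upper_bound m n ltac:(lia)) as Hlt.
      set (q := (m / n)%nat) in *. set (r := (m mod n)%nat) in *.
      destruct (Nat.eq_dec (S r) n) as [E|E].
      + assert (E1 : (S m / n = S q)%nat) by (symmetry; apply (Nat.div_unique _ _ _ 0); nia).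
        assert (E2 : (S m mod n = 0)%nat) by (symmetry; apply (Nat.mod_unique _ _ (S q)); nia).
        rewrite E1, E2, sum_Sn. reflexivity.
      + assert (E1 : (S m / n = q)%nat) by (symmetry; apply (Nat.div_unique _ _ _ (S r)); nia).
        assert (E2 : (S m mod n = S r)%nat) by (symmetry; apply (Nat.mod_unique _ _ q); nia).
        rewrite E1, E2. simpl Nat.eqb. cbv iota. exact (Cplus_0_r _). }
  apply is_CSeries_eps; intros eps He. destruct (proj1 (is_CSeries_eps b s) H eps He) as [N HN].
  exists (S (n * N)). intros [|m] Hm; [lia|]. rewrite Hsum. apply HN.
  apply Nat.div_le_lower_bound; lia.
Qed.

Lemma sparse_mult (n : nat) (b : nat -> C) (c : nat -> C) (k : nat) : (1 <= n)%nat ->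
  (sparse n b k * c k)%C = sparse n (fun j => b j * c (S (n * j)))%C k.
Proof.
  intros Hn. destruct k as [|k]; simpl; [ring|].
  destruct (Nat.eqb_spec (k mod n) 0) as [E|E]; [|ring].
  pose proof (Nat.div_mod_eq k n) as Hdm. rewrite E, Nat.add_0_r in Hdm.
  rewrite Hdm at 2. reflexivity.
Qed.

Lemma sparse_pow (n : nat) (b : nat -> C) (z : C) (k : nat) : (1 <= n)%nat ->
  (sparse n b k * z ^ k)%C = sparse n (fun j => z * (b j * (z ^ n) ^ j))%C k.
Proof.
  intros Hn. rewrite (sparse_mult n b (fun k => z ^ k)%C k Hn).
  destruct k as [|k]; simpl; [reflexivity|]. destruct (Nat.eqb _ _); [|reflexivity].
  rewrite Cpow_mult_r. ring.
Qed.

Lemma Cmod_pow_lt_1 (z : C) (n : nat) : (1 <= n)%nat -> Cmod z < 1 -> Cmod (z ^ n)%C < 1.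
Proof.
  intros Hn Hz. rewrite Cmod_pow. apply pow_lt_1_compat; [split; [apply Cmod_ge_0|exact Hz]|lia].
Qed.

(** * Logarithmic derivative and class membership of the extremal function, and admissibility of the
    radius *)

Section Extremal.

Variables (n : nat) (beta : R).
Hypotheses (Hn : (1 <= n)%nat) (Hbeta : 1 < beta).

Let s := 2 * (beta - 1) / INR n.
Let a := sparse n (fun j => RtoC (binom_coef s j)).

Lemma INR_n_pos : 0 < INR n.
Proof. apply lt_0_INR; lia. Qed.

Lemma extremal_exponent_pos : 0 < s.
Proof. pose proof INR_n_pos. unfold s. apply Rdiv_lt_0_compat; lra. Qed.

Lemma f_extremal_binom (z : C) :
  Cmod z < 1 -> f_extremal n beta z = (z * binom_series s (z ^ n))%C.
Proof.
  intros Hz. unfold f_extremal. rewrite Cpow_Cpow.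
  rewrite binom_series_cpow; [reflexivity|apply extremal_exponent_pos|apply Cmod_pow_lt_1; assumption].
Qed.

Lemma f_extremal_series (z : C) :
  Cmod z < 1 -> is_CSeries (fun k => a k * z ^ k)%C (f_extremal n beta z).
Proof.
  intros Hz. rewrite f_extremal_binom by exact Hz.
  eapply is_CSeries_ext; [intros k; symmetry; apply sparse_pow; exact Hn|].
  apply is_CSeries_sparse; [exact Hn|]. apply is_CSeries_scal.
  apply CPSeries_correct; [apply disc_coefs_binom, extremal_exponent_pos|apply Cmod_pow_lt_1; assumption].
Qed.

Lemma disc_coefs_extremal : disc_coefs a.
Proof. apply disc_coefs_of_convergent. intros z Hz. exists (f_extremal n beta z). exact (f_extremal_series z Hz). Qed.

Lemma f_extremal_CPS (z : C) : Cmod z < 1 -> f_extremal n beta z = CPSeries a z.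
Proof. intros Hz. symmetry. apply CPSeries_unique, f_extremal_series, Hz. Qed.

Lemma extremal_class_A : class_A n (f_extremal n beta).
Proof.
  exists a. split; [reflexivity|]. split; [|split].
  - unfold a, sparse. rewrite Nat.Div0.mod_0_l, Nat.Div0.div_0_l. reflexivity.
  - intros [|k] Hk; [reflexivity|]. unfold a, sparse.
    rewrite Nat.mod_small by lia. destruct k; [lia|reflexivity].
  - intros z Hz. rewrite Cnorm_Cmod in Hz. apply Cseries_to_CS.
    eapply is_CSeries_ext; [|exact (f_extremal_series z Hz)].
    intros k. exact (f_equal (Cmult (a k)) (eq_sym (Cpow_Cpow z k))).
Qed.

(** The product and chain rules for [z B(z^n)], read off termwise: the coefficient at [1 + n j] is
    multiplied by [1 + n j]. *)
Lemma extremal_deriv (z : C) :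
  Cmod z < 1 -> (z * CPSeries (deriv_coef a) z)%C =
    (z * (binom_series s (z ^ n) + RtoC (INR n) * (z ^ n * binom_series_deriv s (z ^ n))))%C.
Proof.
  intros Hz. set (u := (z ^ n)%C).
  pose proof (Cmod_pow_lt_1 z n Hn Hz) as Hu. fold u in Hu.
  pose proof (disc_coefs_binom s extremal_exponent_pos) as Hb.
  set (b := fun j => RtoC (binom_coef s j)) in *.
  rewrite (CPSeries_euler a z disc_coefs_extremal Hz). apply CPSeries_unique.
  unfold binom_series_deriv. fold b. rewrite (CPSeries_euler b u Hb Hu).
  pose proof (CPSeries_correct _ u Hb Hu) as S1.
  pose proof (CPSeries_correct _ u (disc_coefs_INR b Hb) Hu) as S2.
  pose proof (is_CSeries_scal z _ _ (is_CSeries_plus _ _ _ _ S1 (is_CSeries_scal (RtoC (INR n)) _ _ S2))) as S3.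
  apply (is_CSeries_sparse n _ _ Hn) in S3.
  eapply is_CSeries_ext; [|exact S3].
  intros k; cbv beta.
  transitivity (sparse n b k * (RtoC (INR k) * z ^ k))%C.
  2:{ unfold a; fold b. ring. }
  rewrite (sparse_mult n b (fun k => RtoC (INR k) * z ^ k)%C k Hn).
  destruct k as [|k]; cbn [sparse]; [reflexivity|]. destruct (Nat.eqb _ _); [|reflexivity].
  rewrite S_INR, mult_INR, RtoC_plus, RtoC_mult, Cpow_S, Cpow_mult_r. unfold u. ring.
Qed.

Lemma binom_series_nonzero (u : C) : Cmod u < 1 -> binom_series s u <> RtoC 0.
Proof.
  intros Hu E. rewrite binom_series_cpow in E by (auto using extremal_exponent_pos).
  unfold cpow_pos in E. set (r := Rpower _ _) in E. set (t := s * _) in E.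
  assert (Hr : 0 < r) by apply exp_pos.
  pose proof (f_equal fst E) as E1. pose proof (f_equal snd E) as E2. cbn in E1, E2.
  pose proof (sin2_cos2 t) as H. unfold Rsqr in H.
  destruct (Rmult_integral _ _ E1); [lra|]. destruct (Rmult_integral _ _ E2); [lra|].
  rewrite H0, H1 in H. lra.
Qed.

(** With [u = z^n], [Q_f = 1 + n u B' / B]; the differential equation gives
    [B' / B = - s / (1 - u)], and [n s = 2 (beta - 1)]. *)
Lemma Qf_val_extremal (z w : C) : Cmod z < 1 -> z <> RtoC 0 ->
  Qf_val (f_extremal n beta) z w <->
  w = (1 - RtoC (2 * (beta - 1)) * (z ^ n / (1 - z ^ n)))%C.
Proof.
  intros Hz Hnz.
  rewrite (Qf_val_nonzero (f_extremal n beta) a z w disc_coefs_extremal f_extremal_CPS Hz Hnz).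
  rewrite extremal_deriv, f_extremal_binom by exact Hz.
  set (u := (z ^ n)%C). pose proof (Cmod_pow_lt_1 z n Hn Hz) as Hu. fold u in Hu.
  pose proof (binom_series_nonzero u Hu) as Hb.
  pose proof (binom_series_ode s u extremal_exponent_pos Hu) as Hode.
  assert (Hu1 : (1 - u)%C <> RtoC 0).
  { intros E. pose proof (Cmod_ge_0 u). assert (E' : u = RtoC 1).
    { transitivity (1 - (1 - u))%C; [ring|]. rewrite E. ring. }
    rewrite E', Cmod_1 in Hu. lra. }
  assert (Hd : binom_series_deriv s u = (- RtoC s * binom_series s u / (1 - u))%C).
  { rewrite <- Hode. field. exact Hu1. }
  assert (Hs : RtoC (2 * (beta - 1)) = (RtoC s * RtoC (INR n))%C).
  { rewrite <- RtoC_mult. f_equal. unfold s. field. pose proof INR_n_pos; lra. }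
  assert (E : (z * (binom_series s u + RtoC (INR n) * (u * binom_series_deriv s u))
      / (z * binom_series s u))%C = (1 - RtoC (2 * (beta - 1)) * (u / (1 - u)))%C).
  { rewrite Hs, Hd. field. repeat split; assumption. }
  rewrite E. split; [tauto|]. intros H; split; [|exact H]. apply Cmult_neq_0; assumption.
Qed.

(** [u / (1 - u)] maps the disc into the half-plane [Re > -1/2], which turns [1 - 2 (beta - 1) v]
    into [Re < beta]. *)
Lemma Re_ratio_gt (u : C) : Cmod u < 1 -> - (1 / 2) < fst (u / (1 - u))%C.
Proof.
  intros Hu. destruct u as [x y].
  assert (Hxy : x * x + y * y < 1).
  { pose proof (Cmod_sqr (x, y)) as E. cbn [fst snd] in E. pose proof (Cmod_ge_0 (x, y)). nra. }
  assert (Hq : 0 < (1 - x) * (1 - x) + y * y) by nra.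
  replace (fst ((x, y) / (1 - (x, y)))%C) with ((x * (1 - x) - y * y) / ((1 - x) * (1 - x) + y * y)).
  2:{ unfold Cdiv, Cinv, Cmult, Cminus, Cplus, Copp, RtoC. cbn. field. lra. }
  apply (proj1 (Rlt_div_r _ _ _ Hq)). nra.
Qed.

Lemma extremal_class_M : class_M n beta (f_extremal n beta).
Proof.
  split; [exact extremal_class_A|]. intros z Hz. rewrite Cnorm_Cmod in Hz.
  destruct (Ceq_dec z 0) as [->|Hnz].
  - exists (RtoC 1). split; [left; split; reflexivity|]. exact Hbeta.
  - eexists. split; [apply (Qf_val_extremal z _ Hz Hnz); reflexivity|].
    pose proof (Re_ratio_gt _ (Cmod_pow_lt_1 z n Hn Hz)) as H.
    set (v := (z ^ n / (1 - z ^ n))%C) in *.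
    change (1 + - (2 * (beta - 1) * fst v - 0 * snd v) < beta). nra.
Qed.

Let rho := Rpower (3 * beta - 2) (- (1 / INR n)).

Lemma rho_pow : rho ^ n = / (3 * beta - 2).
Proof.
  unfold rho. rewrite <- Rpower_pow by apply exp_pos. rewrite Rpower_mult.
  replace (- (1 / INR n) * INR n) with (- (1)) by (field; pose proof INR_n_pos; lra).
  rewrite Rpower_Ropp, Rpower_1; [reflexivity|lra].
Qed.

Lemma rho_bounds : 0 < rho < 1.
Proof.
  split; [apply exp_pos|]. unfold rho. pose proof INR_n_pos.
  assert (0 < 1 / INR n) by (apply Rdiv_lt_0_compat; lra).
  rewrite <- (Rpower_O (3 * beta - 2) ltac:(lra)) at 2.
  apply Rpower_lt; lra.
Qed.

Lemma rho_admissible : radius_admissible (class_M n beta) rho.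
Proof.
  pose proof rho_bounds. split; [lra|]. intros f Hf z Hz. rewrite Cnorm_Cmod in Hz.
  destruct (Ceq_dec z 0) as [->|Hnz].
  - exists (RtoC 1). split; [left; split; reflexivity|]. apply disc_in_Omega_Ne.
    replace (RtoC 1 - 1)%C with (RtoC 0) by ring. rewrite Cmod_0; lra.
  - assert (Hz1 : Cnorm z < 1) by (rewrite Cnorm_Cmod; apply (Rlt_trans _ rho); tauto).
    destruct (proj2 Hf z Hz1) as [w [Hw _]].
    exists w. split; [exact Hw|].
    destruct (class_M_schwarz n beta f rho z w Hn Hbeta Hf (Rlt_le _ _ (proj2 H)) Hnz Hz Hw)
      as [omega [Ho E]].
    rewrite rho_pow in Ho. apply disc_in_Omega_Ne.
    exact (log_derivative_bound beta _ omega Hbeta Ho E).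
Qed.

Lemma Qf_val_extremal_rho (w : C) :
  Qf_val (f_extremal n beta) (RtoC rho) w <-> w = RtoC (1 / 3).
Proof.
  pose proof rho_bounds.
  rewrite Qf_val_extremal.
  - rewrite <- RtoC_pow, rho_pow.
    assert (E : (1 - RtoC (2 * (beta - 1)) * (RtoC (/ (3 * beta - 2)) / (1 - RtoC (/ (3 * beta - 2)))))%C
      = RtoC (1 / 3)).
    { assert (/ (3 * beta - 2) < 1) by (rewrite <- Rinv_1; apply Rinv_lt_contravar; lra).
      rewrite <- !RtoC_minus, <- RtoC_div, <- RtoC_mult, <- RtoC_minus by lra.
      f_equal. field. lra. }
    rewrite E. tauto.
  - rewrite Cmod_R, Rabs_pos_eq; lra.
  - intros E. apply RtoC_inj in E. lra.
Qed.

End Extremal.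

(** * The boundary point 1/3 and sharpness *)

(** [phi_Ne u = 1/3] amounts to [(u + 1)^2 (u - 2) = 0], whose roots lie outside the open disc. *)
Lemma third_notin_Omega_Ne : ~ in_Omega_Ne (RtoC (1 / 3)).
Proof.
  intros [u [Hu E]]. rewrite Cnorm_Cmod in Hu. unfold phi_Ne in E. rewrite Cpow_Cpow in E.
  change (RtoC (1 / 3) = 1 + (u - RtoC (1 / 3) * u ^ 3))%C in E.
  assert (E' : ((u + 1) * (u + 1) * (u - 2))%C = RtoC 0).
  (* [ring] sees [RtoC (1 / 3)] as an atom; the correction term vanishes once [3 * (1 / 3)] is
     evaluated. *)
  { transitivity (RtoC 3 * (RtoC (1 / 3) * u ^ 3 - u - 1 + RtoC (1 / 3))
        + (1 - RtoC 3 * RtoC (1 / 3)) * (u ^ 3 + 1))%C; [ring|].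
    rewrite E at 2. rewrite <- RtoC_mult. replace (3 * (1 / 3)) with 1 by field. ring. }
  assert (H : forall c : C, 1 <= Cmod c -> (u - c)%C <> RtoC 0).
  { intros c Hc E0. assert (u = c) as -> by (apply Ceq_minus; exact E0). lra. }
  assert (H1 : (u + 1)%C <> RtoC 0).
  { replace (u + 1)%C with (u - - (1))%C by ring. apply H. rewrite Cmod_m1; lra. }
  assert (H2 : (u - 2)%C <> RtoC 0).
  { apply H. rewrite Cmod_R, Rabs_pos_eq; lra. }
  exact (Cmult_neq_0 _ _ (Cmult_neq_0 _ _ H1 H1) H2 E').
Qed.

(* [1/3 = phi_Ne (-1)]. *)
Lemma third_boundary_Omega_Ne : on_boundary_Omega_Ne (RtoC (1 / 3)).
Proof.
  split; [exact third_notin_Omega_Ne|]. intros eps He.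
  (* Approach from the right along the real axis: [1/3 + d] has distance [2/3 - d] from 1. *)
  set (d := Rmin (eps / 2) (1 / 2)).
  assert (Hd : 0 < d) by (apply Rmin_glb_lt; lra).
  pose proof (Rmin_l (eps / 2) (1 / 2)). pose proof (Rmin_r (eps / 2) (1 / 2)).
  fold d in H, H0.
  exists (RtoC (1 / 3 + d)). split.
  - apply disc_in_Omega_Ne. rewrite <- RtoC_minus, Cmod_R. apply Rabs_def1; lra.
  - rewrite Cnorm_Cmod. change (Cmod (RtoC (1 / 3 + d) - RtoC (1 / 3))%C < eps).
    rewrite <- RtoC_minus, Cmod_R. apply Rabs_def1; lra.
Qed.

Theorem mainTheorem12 (n : nat) (beta : R) (hn : (1 <= n)%nat) (hbeta : 1 < beta) :
  is_radius (class_M n beta) (Rpower (3 * beta - 2) (- (1 / INR n))) /\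
  class_M n beta (f_extremal n beta) /\
  exists z : Cx, Cnorm z = Rpower (3 * beta - 2) (- (1 / INR n)) /\
    Qf_sat (f_extremal n beta) z on_boundary_Omega_Ne.
Proof.
  pose proof (rho_bounds n beta hn hbeta) as Hrho.
  set (rho := Rpower (3 * beta - 2) (- (1 / INR n))) in *.
  assert (Hnorm : Cnorm (RtoC rho) = rho) by (rewrite Cnorm_Cmod, Cmod_R, Rabs_pos_eq; lra).
  split; [split|split].
  - exact (rho_admissible n beta hn hbeta).
  (* A larger radius would put the point [rho] inside its disc, where the extremal function takes
     the excluded value 1/3. *)
  - intros r [_ Hadm]. apply Rnot_lt_le; intros Hlt.
    destruct (Hadm _ (extremal_class_M n beta hn hbeta) (RtoC rho)) as [w [Hw Hin]].
    { rewrite Hnorm; exact Hlt. }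
    apply (Qf_val_extremal_rho n beta hn hbeta) in Hw. subst w.
    exact (third_notin_Omega_Ne Hin).
  - exact (extremal_class_M n beta hn hbeta).
  - exists (RtoC rho). split; [exact Hnorm|]. exists (RtoC (1 / 3)).
    split; [|exact third_boundary_Omega_Ne].
    apply (Qf_val_extremal_rho n beta hn hbeta). reflexivity.
Qed.
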